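(* For every $\tau$ in the upper half plane with $\operatorname{Im}(\tau)>1.25$ one has $$\frac{1}{2\pi \operatorname{Im}(\tau)}\sqrt{\frac{J(\tau)}{J(\tau)-1}} = \sum_{n=0}^\infty \left( \frac{1-s_2(\tau)}{6} + n \right)\cdot \frac{(6n)!}{(3n)!\,(n!)^3}\cdot \frac{1}{\left(1728J(\tau)\right)^n},$$ where $\sqrt{\cdot}$ denotes the principal branch of the square root (and the series converges absolutely).
   Context: For $\tau$ in the upper half plane $\mathbb H=\{\tau\in\mathbb C:\operatorname{Im}\tau>0\}$ put $q=e^{2\pi i\tau}$ and define the normalized Eisenstein series $E_2(\tau)=1-24\sum_{n\ge1} n\frac{q^n}{1-q^n}$, $E_4(\tau)=1+240\sum_{n\ge1} n^3\frac{q^n}{1-q^n}$, $E_6(\tau)=1-504\sum_{n\ge1} n^5\frac{q^n}{1-q^n}$. Define $J(\tau)=\dfrac{E_4(\tau)^3}{E_4(\tau)^3-E_6(\tau)^2}$ and $s_2(\tau)=\dfrac{E_4(\tau)}{E_6(\tau)}\left(E_2(\tau)-\dfrac{3}{\pi\operatorname{Im}(\tau)}\right)$. *)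

(* Defs.v *)
From Stdlib Require Import Reals Lra Arith ClassicalEpsilon.
Open Scope R_scope.

Record Cpx := mkC { Re : R; Im : R }.

Definition C0 : Cpx := mkC 0 0.
Definition C1 : Cpx := mkC 1 0.
Definition RtoC (x : R) : Cpx := mkC x 0.
Definition Cadd (z w : Cpx) : Cpx := mkC (Re z + Re w) (Im z + Im w).
Definition Copp (z : Cpx) : Cpx := mkC (- Re z) (- Im z).
Definition Csub (z w : Cpx) : Cpx := Cadd z (Copp w).
Definition Cmul (z w : Cpx) : Cpx :=
  mkC (Re z * Re w - Im z * Im w) (Re z * Im w + Im z * Re w).
Definition Cnorm (z : Cpx) : R := sqrt (Re z * Re z + Im z * Im z).
(* inverse; total, with Cinv 0 = 0 (irrelevant where used) *)
Definition Cinv (z : Cpx) : Cpx :=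
  let d := Re z * Re z + Im z * Im z in mkC (Re z / d) (- Im z / d).
Definition Cdiv (z w : Cpx) : Cpx := Cmul z (Cinv w).
Fixpoint Cpow (z : Cpx) (n : nat) : Cpx :=
  match n with O => C1 | S m => Cmul z (Cpow z m) end.

Definition Cexp (z : Cpx) : Cpx := mkC (exp (Re z) * cos (Im z)) (exp (Re z) * sin (Im z)).

(** principal branch of the square root (branch cut on the negative reals,
    with sqrt of a negative real x equal to i*sqrt(|x|)) *)
Definition Csqrt (z : Cpx) : Cpx :=
  let r := Cnorm z in
  mkC (sqrt ((r + Re z) / 2))
      (if Rlt_dec (Im z) 0 then - sqrt ((r - Re z) / 2) else sqrt ((r - Re z) / 2)).

Definition Ccv (u : nat -> Cpx) (l : Cpx) : Prop :=
  Un_cv (fun n => Re (u n)) (Re l) /\ Un_cv (fun n => Im (u n)) (Im l).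

Fixpoint Cpartial (f : nat -> Cpx) (n : nat) : Cpx :=
  match n with O => f O | S m => Cadd (Cpartial f m) (f (S m)) end.

Definition Cseries_cv (f : nat -> Cpx) (l : Cpx) : Prop := Ccv (Cpartial f) l.

Definition Cseries_abs_cv (f : nat -> Cpx) : Prop :=
  exists l : R, Un_cv (sum_f_R0 (fun n => Cnorm (f n))) l.

Definition Cseries (f : nat -> Cpx) : Cpx :=
  epsilon (inhabits C0) (fun l => Cseries_cv f l).

Definition qn (tau : Cpx) : Cpx := Cexp (Cmul (mkC 0 (2 * PI)) tau).

Definition lambert (k : nat) (tau : Cpx) : Cpx :=
  Cseries (fun m => let n := S m in
     Cmul (RtoC (INR n ^ k))
          (Cdiv (Cpow (qn tau) n) (Csub C1 (Cpow (qn tau) n)))).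

Definition E2 (tau : Cpx) : Cpx := Csub C1 (Cmul (RtoC 24) (lambert 1 tau)).
Definition E4 (tau : Cpx) : Cpx := Cadd C1 (Cmul (RtoC 240) (lambert 3 tau)).
Definition E6 (tau : Cpx) : Cpx := Csub C1 (Cmul (RtoC 504) (lambert 5 tau)).

Definition Jf (tau : Cpx) : Cpx :=
  Cdiv (Cpow (E4 tau) 3) (Csub (Cpow (E4 tau) 3) (Cpow (E6 tau) 2)).

Definition s2 (tau : Cpx) : Cpx :=
  Cmul (Cdiv (E4 tau) (E6 tau)) (Csub (E2 tau) (RtoC (3 / (PI * Im tau)))).

Definition ram_term (tau : Cpx) (n : nat) : Cpx :=
  Cmul (Cadd (Cdiv (Csub C1 (s2 tau)) (RtoC 6)) (RtoC (INR n)))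
   (Cmul (RtoC (INR (Factorial.fact (6 * n)) / (INR (Factorial.fact (3 * n)) * INR (Factorial.fact n) ^ 3)))
         (Cinv (Cpow (Cmul (RtoC 1728) (Jf tau)) n))).

Definition ram_lhs (tau : Cpx) : Cpx :=
  Cmul (RtoC (1 / (2 * PI * Im tau)))
       (Csqrt (Cdiv (Jf tau) (Csub (Jf tau) C1))).

(* Main.v *)
Require Import Defs.
From Stdlib Require Import Reals Ranalysis5 Machin Factorial Lra Lia Psatz List ClassicalEpsilon.
From Coquelicot Require Import Coquelicot.
Open Scope R_scope.

(** Write [D = q d/dq], [P, Q, R] for the Eisenstein series E_2, E_4, E_6 as functions of [q],
    [S = R/Q], [y = 1/J = 1 - S^2/Q], and let [W_k] be the sum of [n^k b_n y^n] with
    [b_n = (6n)! / ((3n)! n!^3 1728^n)].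

    Ramanujan's equations for [DP], [DQ], [DR] come from one identity for Lambert series: with
    [L_a = q^a/(1-q^a)] one has [L_a L_b = L_(a+b) (1 + L_a + L_b)], and for a polynomial [H]
    which is symmetric and satisfies [H(x,y) - H(x-y,y) = H(y,x) - H(y-x,x)] this telescopes to
    [sum_(a,b) (H(a,b) - H(a-b,b)) L_a L_b
       = sum_c (sum_(0<a<c) H(a,c-a)) L_c - sum_c H(0,c) L_c^2].
    The choices x^2+xy+y^2, its square and cube, and (xy(x+y))^2 give all that is needed.

    Then [Dy = S y] and [D W_k = S W_(k+1)], so the hypergeometric equation of [W_0] as a function
    of [y] becomes [N^3 W_0 = 0] for the operator [N = D - (P - S)/6].  A solution [f] of [N f = 0]
    has [f^2/Q] constant, hence vanishes as soon as it vanishes at [q = 0]; applied to [N^2 W_0] and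
    [N W_0] this gives [N W_0 = 0] and [W_0^2 = Q].  The first equation expresses [W_1] through
    [W_0], which turns the series of the theorem into [W_0 / (2 pi Im(tau) S)]; the second says that
    [W_0/S] is a square root of [J/(J-1)], and it is the principal one because its real part cannot
    change sign along the ray from 0 to [q].  Everything takes place on [|q| < 1/2500], where
    [|y| < 1]. *)

(** * Complex series and complex derivatives *)

(** Convergence is taken componentwise, so that theorems on real series apply directly and the
    limits agree with [Ccv]. *)
Definition is_cseries (f : nat -> C) (l : C) : Prop :=
  is_series (fun n => fst (f n)) (fst l) /\ is_series (fun n => snd (f n)) (snd l).

Definition csum (f : nat -> C) : C :=
  (Series (fun n => fst (f n)), Series (fun n => snd (f n))).

Lemma is_cseries_unique (f : nat -> C) (l : C) : is_cseries f l -> csum f = l.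
Proof.
  intros [H1 H2]. unfold csum. rewrite (is_series_unique _ _ H1), (is_series_unique _ _ H2).
  now destruct l.
Qed.

Lemma is_cseries_ext (f g : nat -> C) (l : C) :
  (forall n, f n = g n) -> is_cseries f l -> is_cseries g l.
Proof.
  intros E [H1 H2]; split; eapply is_series_ext; try eassumption;
    intros n; simpl; now rewrite E.
Qed.

Lemma is_cseries_plus (f g : nat -> C) (l m : C) :
  is_cseries f l -> is_cseries g m -> is_cseries (fun n => f n + g n)%C (l + m)%C.
Proof.
  intros [H1 H2] [H3 H4]; split.
  - exact (is_series_plus _ _ _ _ H1 H3).
  - exact (is_series_plus _ _ _ _ H2 H4).
Qed.

Lemma is_cseries_scal (c : C) (f : nat -> C) (l : C) :
  is_cseries f l -> is_cseries (fun n => c * f n)%C (c * l)%C.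
Proof.
  intros [H1 H2]; split; simpl.
  - exact (is_series_minus _ _ _ _ (is_series_scal (fst c) _ _ H1) (is_series_scal (snd c) _ _ H2)).
  - exact (is_series_plus _ _ _ _ (is_series_scal (fst c) _ _ H2) (is_series_scal (snd c) _ _ H1)).
Qed.

Lemma is_cseries_minus (f g : nat -> C) (l m : C) :
  is_cseries f l -> is_cseries g m -> is_cseries (fun n => f n - g n)%C (l - m)%C.
Proof.
  intros H1 H2. replace (l - m)%C with (l + (- (1)) * m)%C by ring.
  apply is_cseries_ext with (fun n => f n + (- (1)) * g n)%C. { intros n; ring. }
  apply is_cseries_plus, is_cseries_scal; assumption.
Qed.

Lemma is_cseries_decr_1 (f : nat -> C) (l : C) :
  f 0%nat = 0 -> is_cseries (fun n => f (S n)) l -> is_cseries f l.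
Proof.
  intros E [H1 H2]; split; apply is_series_decr_1; rewrite E; simpl;
    [change (plus (fst l) (opp 0)) with (fst l + - 0) | change (plus (snd l) (opp 0)) with (snd l + - 0)];
    rewrite Ropp_0, Rplus_0_r; assumption.
Qed.

Lemma is_cseries_incr_1 (f : nat -> C) (l : C) :
  f 0%nat = 0 -> is_cseries f l -> is_cseries (fun n => f (S n)) l.
Proof.
  intros E [H1 H2]; split.
  - apply (is_series_incr_1 (fun n => fst (f n))). rewrite E; simpl.
    change (plus (fst l) 0) with (fst l + 0). now rewrite Rplus_0_r.
  - apply (is_series_incr_1 (fun n => snd (f n))). rewrite E; simpl.
    change (plus (snd l) 0) with (snd l + 0). now rewrite Rplus_0_r.
Qed.

Lemma Rabs_fst_le_Cmod (z : C) : Rabs (fst z) <= Cmod z.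
Proof. eapply Rle_trans; [apply Rmax_l | apply Rmax_Cmod]. Qed.

Lemma Rabs_snd_le_Cmod (z : C) : Rabs (snd z) <= Cmod z.
Proof. eapply Rle_trans; [apply Rmax_r | apply Rmax_Cmod]. Qed.

Lemma is_cseries_dominated (f : nat -> C) (M : nat -> R) :
  (forall n, Cmod (f n) <= M n) -> ex_series M -> is_cseries f (csum f).
Proof.
  intros H HM; split; apply Series_correct; apply (@ex_series_le R_AbsRing R_CompleteNormedModule _ M); auto; intros n;
    (eapply Rle_trans; [|apply H]).
  - apply Rabs_fst_le_Cmod.
  - apply Rabs_snd_le_Cmod.
Qed.

Lemma is_series_le_compat (a b : nat -> R) (l m : R) :
  (forall n, a n <= b n) -> is_series a l -> is_series b m -> l <= m.
Proof.
  intros H Ha Hb. apply (is_lim_seq_le (sum_n a) (sum_n b) (Finite l) (Finite m)); auto.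
  intros n. apply sum_n_m_le. exact H.
Qed.

(* Rotate the sum to the positive real axis, where the real part is the modulus. *)
Lemma Cmod_cseries_le (f : nat -> C) (M : nat -> R) (l : C) (s : R) :
  (forall n, Cmod (f n) <= M n) -> is_series M s -> is_cseries f l -> Cmod l <= s.
Proof.
  intros H HM Hl. destruct (Ceq_dec l 0) as [->|Hn].
  - rewrite Cmod_0. apply is_series_le_compat with (fun _ => 0) M; auto.
    + intros n. eapply Rle_trans; [apply Cmod_ge_0 | apply H].
    + pose proof (is_series_scal 0 _ _ HM) as K.
      change (scal 0 s) with (0 * s) in K. rewrite Rmult_0_l in K.
      eapply is_series_ext; [|exact K]. intros n. apply (Rmult_0_l (M n)).
  - pose proof (proj1 (Cmod_gt_0 l) Hn) as Hp.
    set (w := (Cconj l * / Cmod l)%C).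
    assert (Hc : RtoC (Cmod l) <> 0) by (intros E; apply RtoC_inj in E; lra).
    assert (Ew : Cmod w = 1).
    { unfold w. rewrite Cmod_mult, Cmod_conj, Cmod_inv by assumption.
      rewrite Cmod_R, Rabs_pos_eq by lra. field. lra. }
    assert (El : (w * l)%C = RtoC (Cmod l)).
    { unfold w. transitivity ((l * Cconj l) * / Cmod l)%C; [ring|].
      rewrite <- Cmod2_conj. rewrite RtoC_pow. field. assumption. }
    pose proof (is_cseries_scal w _ _ Hl) as [K _]. rewrite El in K.
    refine (is_series_le_compat _ _ _ _ _ K HM). intros n.
    eapply Rle_trans; [apply Rle_abs|]. eapply Rle_trans; [apply Rabs_fst_le_Cmod|].
    rewrite Cmod_mult, Ew, Rmult_1_l. apply H.
Qed.

(** * Continuity and complex differentiability at a point *)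

Definition ccont (f : C -> C) (z : C) : Prop :=
  forall eps, 0 < eps -> exists d, 0 < d /\
    forall w, Cmod (w - z) < d -> Cmod (f w - f z) < eps.

Lemma ccont_const (c z : C) : ccont (fun _ => c) z.
Proof.
  intros e He; exists 1; split; [lra|]; intros w _.
  replace (c - c)%C with (RtoC 0) by ring. now rewrite Cmod_0.
Qed.

Lemma ccont_id (z : C) : ccont (fun w => w) z.
Proof. intros e He; exists e; split; auto. Qed.

Lemma ccont_plus (f g : C -> C) (z : C) :
  ccont f z -> ccont g z -> ccont (fun w => f w + g w)%C z.
Proof.
  intros Hf Hg e He. destruct (Hf (e/2)) as [d1 [P1 D1]]; [lra|].
  destruct (Hg (e/2)) as [d2 [P2 D2]]; [lra|].
  exists (Rmin d1 d2); split; [apply Rmin_case; auto|]. intros w Hw.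
  replace (f w + g w - (f z + g z))%C with ((f w - f z) + (g w - g z))%C by ring.
  eapply Rle_lt_trans; [apply Cmod_triangle|].
  pose proof (D1 w (Rlt_le_trans _ _ _ Hw (Rmin_l _ _))).
  pose proof (D2 w (Rlt_le_trans _ _ _ Hw (Rmin_r _ _))). lra.
Qed.

Lemma ccont_mult (f g : C -> C) (z : C) :
  ccont f z -> ccont g z -> ccont (fun w => f w * g w)%C z.
Proof.
  intros Hf Hg e He.
  pose proof (Cmod_ge_0 (f z)) as Af. pose proof (Cmod_ge_0 (g z)) as Ag.
  set (k := Cmod (f z) + Cmod (g z) + 1).
  (* The bound 1 makes the product of the two increments at most [e1], so the whole increment is at
     most [e1 * k], hence at most e/2. *)
  set (e1 := Rmin 1 (e / (2 * k))).
  assert (Hk : 1 <= k) by (unfold k; lra).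
  assert (He1 : 0 < e1).
  { unfold e1; apply Rmin_case; [lra|]. apply Rdiv_lt_0_compat; lra. }
  assert (E1 : e1 <= 1) by apply Rmin_l.
  assert (E2 : e1 * k <= e / 2).
  { apply Rle_trans with (e / (2 * k) * k).
    - apply Rmult_le_compat_r; [lra|apply Rmin_r].
    - right; field; lra. }
  destruct (Hf e1 He1) as [d1 [P1 D1]]. destruct (Hg e1 He1) as [d2 [P2 D2]].
  exists (Rmin d1 d2); split; [apply Rmin_case; auto|]. intros w Hw.
  replace (f w * g w - f z * g z)%C
    with ((f w - f z) * (g w - g z) + (f w - f z) * g z + f z * (g w - g z))%C by ring.
  pose proof (D1 w (Rlt_le_trans _ _ _ Hw (Rmin_l _ _))) as X.
  pose proof (D2 w (Rlt_le_trans _ _ _ Hw (Rmin_r _ _))) as Y.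
  pose proof (Cmod_ge_0 (f w - f z)). pose proof (Cmod_ge_0 (g w - g z)).
  eapply Rle_lt_trans; [apply Cmod_triangle|].
  eapply Rle_lt_trans; [apply Rplus_le_compat_r, Cmod_triangle|].
  rewrite !Cmod_mult. unfold k in E2.
  assert (Cmod (f w - f z) * Cmod (g w - g z) <= e1 * 1) by (apply Rmult_le_compat; lra).
  assert (Cmod (f w - f z) * Cmod (g z) <= e1 * Cmod (g z)) by (apply Rmult_le_compat_r; lra).
  assert (Cmod (f z) * Cmod (g w - g z) <= Cmod (f z) * e1) by (apply Rmult_le_compat_l; lra).
  lra.
Qed.

Lemma ccont_inv (f : C -> C) (z : C) :
  ccont f z -> f z <> 0 -> ccont (fun w => / f w)%C z.
Proof.
  intros Hf Hn e He. pose proof (proj1 (Cmod_gt_0 _) Hn) as Hp.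
  set (m := Cmod (f z)) in *.
  (* The first bound keeps |f w| above m/2, hence |f w| |f z| above m^2/2; the second is then what
     the quotient needs. *)
  destruct (Hf (Rmin (m / 2) (e * (m * m / 2)))) as [d [P D]].
  { apply Rmin_case; [lra|]. repeat apply Rmult_lt_0_compat; lra. }
  exists d; split; auto. intros w Hw. specialize (D w Hw).
  pose proof (Rlt_le_trans _ _ _ D (Rmin_l _ _)) as X.
  pose proof (Rlt_le_trans _ _ _ D (Rmin_r _ _)) as Y.
  assert (Hw' : m / 2 < Cmod (f w)).
  { pose proof (Cmod_triangle (f w) (- (f w - f z))) as T.
    replace (f w + - (f w - f z))%C with (f z) in T by ring. rewrite Cmod_opp in T. fold m in T. lra. }
  assert (Hw0 : f w <> 0) by (apply Cmod_gt_0; lra).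
  replace (/ f w - / f z)%C with (- (f w - f z) / (f w * f z))%C by (field; auto).
  rewrite Cmod_div by (now apply Cmult_neq_0). rewrite Cmod_opp, Cmod_mult. fold m.
  apply Rlt_div_l; [apply Rmult_lt_0_compat; lra|].
  eapply Rlt_le_trans; [exact Y|].
  apply Rmult_le_compat_l; [lra|]. nra.
Qed.

Lemma ccont_comp (f g : C -> C) (z : C) :
  ccont g z -> ccont f (g z) -> ccont (fun w => f (g w)) z.
Proof.
  intros Hg Hf e He. destruct (Hf e He) as [d1 [P1 D1]]. destruct (Hg d1 P1) as [d2 [P2 D2]].
  exists d2; split; auto.
Qed.

Lemma ccont_ext (f g : C -> C) (z : C) :
  (forall w, f w = g w) -> ccont f z -> ccont g z.
Proof.
  intros E H e He. destruct (H e He) as [d [P D]]. exists d; split; auto.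
  intros w Hw. rewrite <- !E. auto.
Qed.

(* Caratheodory's form of differentiability: the rules below become identities between slopes. *)
Definition cder (f : C -> C) (z l : C) : Prop :=
  exists phi : C -> C, (forall w, f w = f z + (w - z) * phi w)%C /\ phi z = l /\ ccont phi z.

Lemma cder_ext (f g : C -> C) (z l : C) :
  (forall w, f w = g w) -> cder f z l -> cder g z l.
Proof. intros E [p [H1 H2]]; exists p; split; auto. intros w; rewrite <- !E; auto. Qed.

Lemma cder_ccont (f : C -> C) (z l : C) : cder f z l -> ccont f z.
Proof.
  intros [p [H1 [H2 H3]]].
  apply ccont_ext with (fun w => f z + (w + - z) * p w)%C. { intros w. symmetry. apply H1. }
  apply (ccont_plus (fun _ => f z)); [apply ccont_const|].
  apply (ccont_mult (fun w => w + - z)%C); auto.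
  apply (ccont_plus (fun w => w) (fun _ => - z)%C); [apply ccont_id|apply ccont_const].
Qed.

Lemma cder_const (c z : C) : cder (fun _ => c) z 0.
Proof. exists (fun _ => RtoC 0); repeat split; [intros; ring | apply ccont_const]. Qed.

Lemma cder_plus (f g : C -> C) (z l m : C) :
  cder f z l -> cder g z m -> cder (fun w => f w + g w)%C z (l + m)%C.
Proof.
  intros [p [H1 [H2 H3]]] [p' [H1' [H2' H3']]].
  exists (fun w => p w + p' w)%C; repeat split.
  - intros w. rewrite (H1 w), (H1' w). ring.
  - now rewrite H2, H2'.
  - now apply ccont_plus.
Qed.

Lemma cder_mult (f g : C -> C) (z l m : C) :
  cder f z l -> cder g z m -> cder (fun w => f w * g w)%C z (l * g z + f z * m)%C.
Proof.
  intros [p [H1 [H2 H3]]] Hg. pose proof (cder_ccont _ _ _ Hg) as Cg.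
  destruct Hg as [p' [H1' [H2' H3']]].
  exists (fun w => p w * g w + f z * p' w)%C; repeat split.
  - intros w. rewrite (H1' w), (H1 w). ring.
  - now rewrite H2, H2'.
  - apply (ccont_plus (fun w => p w * g w)%C); apply ccont_mult; auto. apply ccont_const.
Qed.

Lemma cder_comp (f g : C -> C) (z l m : C) :
  cder g z m -> cder f (g z) l -> cder (fun w => f (g w)) z (l * m)%C.
Proof.
  intros Hg [p [H1 [H2 H3]]]. pose proof (cder_ccont _ _ _ Hg) as Cg.
  destruct Hg as [p' [H1' [H2' H3']]].
  exists (fun w => p (g w) * p' w)%C; repeat split.
  - intros w. rewrite (H1 (g w)). rewrite (H1' w) at 1. ring.
  - now rewrite H2, H2'.
  - apply (ccont_mult (fun w => p (g w))); auto. now apply ccont_comp.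
Qed.

Lemma cder_inv (z : C) : z <> 0 -> cder (fun w => / w)%C z (- / (z * z))%C.
Proof.
  intros Hz.
  (* The slope is -1/(wz). At w = 0 the convention / 0 = 0 forces the value 1/z^2; continuity at z
     is not affected, because 0 is at distance |z|. *)
  exists (fun w => if Ceq_dec w 0 then (/ z * / z)%C else - (/ w * / z))%C.
  repeat split.
  - intros w. destruct (Ceq_dec w 0) as [->|Hw].
    + replace (/ 0)%C with (RtoC 0); [field; auto|].
      apply injective_projections; simpl; unfold Rdiv; ring.
    + field; auto.
  - destruct (Ceq_dec z 0); [contradiction|]. field; auto.
  - pose proof (ccont_mult _ _ _ (ccont_const (- / z)%C z) (ccont_inv _ _ (ccont_id z) Hz)) as K.
    intros e He. destruct (K e He) as [d [P D]].
    exists (Rmin d (Cmod z)). split; [apply Rmin_case; auto; now apply Cmod_gt_0|].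
    intros w Hw. pose proof (Rlt_le_trans _ _ _ Hw (Rmin_r _ _)) as X.
    destruct (Ceq_dec z 0); [contradiction|].
    destruct (Ceq_dec w 0) as [->|Hw0].
    + replace (0 - z)%C with (- z)%C in X by ring. rewrite Cmod_opp in X. lra.
    + specialize (D w (Rlt_le_trans _ _ _ Hw (Rmin_l _ _))). simpl in D.
      replace (- (/ w * / z) - - (/ z * / z))%C with (- / z * / w - - / z * / z)%C by ring. auto.
Qed.

(** The difference quotient is within K |h| of l, so it extends continuously by l. Remainder bounds
    of this shape can be added over the terms of a series. *)
Lemma cder_of_quadratic (f : C -> C) (z l : C) (r K : R) :
  0 < r ->
  (forall h, Cmod h < r -> Cmod (f (z + h) - f z - h * l)%C <= K * Cmod h ^ 2) ->
  cder f z l.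
Proof.
  intros Hr H.
  exists (fun w => if Ceq_dec w z then l else (f w - f z) / (w - z))%C.
  repeat split.
  - intros w. destruct (Ceq_dec w z) as [->|Hw]; [ring|]. field.
    intros E. apply Hw. replace w with ((w - z) + z)%C by ring. rewrite E. ring.
  - now destruct (Ceq_dec z z).
  - intros e He. exists (Rmin r (e / (Rabs K + 1))).
    pose proof (Rabs_pos K) as PK.
    split; [apply Rmin_case; auto; apply Rdiv_lt_0_compat; lra|].
    intros w Hw. destruct (Ceq_dec z z) as [_|]; [|congruence].
    destruct (Ceq_dec w z) as [->|Hn].
    { replace (l - l)%C with (RtoC 0) by ring. now rewrite Cmod_0. }
    assert (Hh : (w - z)%C <> 0).
    { intros E. apply Hn. replace w with ((w - z) + z)%C by ring. rewrite E. ring. }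
    pose proof (H (w - z)%C (Rlt_le_trans _ _ _ Hw (Rmin_l _ _))) as B.
    replace (z + (w - z))%C with w in B by ring.
    pose proof (proj1 (Cmod_gt_0 _) Hh) as Hp.
    replace ((f w - f z) / (w - z) - l)%C with ((f w - f z - (w - z) * l) / (w - z))%C by (field; auto).
    rewrite Cmod_div by auto. apply Rlt_div_l; auto.
    pose proof (Rlt_le_trans _ _ _ Hw (Rmin_r _ _)) as X.
    apply Rlt_div_r in X; [|lra]. pose proof (Rle_abs K). nra.
Qed.

(** Termwise differentiation: the remainders M n |h|^2 add up to S |h|^2 with S the sum of [M],
    which takes the place of a uniform convergence argument. *)
Lemma cder_cseries (f : nat -> C -> C) (F : C -> C) (g : nat -> C) (G z : C) (r : R) (M : nat -> R) :
  0 < r -> ex_series M ->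
  (forall h, Cmod h < r -> is_cseries (fun n => f n (z + h)%C) (F (z + h)%C)) ->
  is_cseries g G ->
  (forall n h, Cmod h < r -> Cmod (f n (z + h) - f n z - h * g n)%C <= M n * Cmod h ^ 2) ->
  cder F z G.
Proof.
  intros Hr [S HS] HF HG HM.
  apply cder_of_quadratic with r S; auto. intros h Hh.
  assert (H0 : is_cseries (fun n => f n z) (F z)).
  { pose proof (HF 0) as K. rewrite Cmod_0 in K. specialize (K Hr).
    replace (z + 0)%C with z in K by ring. exact K. }
  apply Cmod_cseries_le with (fun n => f n (z + h) - f n z - h * g n)%C (fun n => M n * Cmod h ^ 2).
  - intros n; auto.
  - apply (is_series_scal_r (Cmod h ^ 2)). exact HS.
  - apply (is_cseries_minus (fun n => f n (z + h) - f n z)%C (fun n => h * g n)%C);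
      [apply is_cseries_minus | apply is_cseries_scal]; auto.
Qed.


(** * Restriction to rays from 0, and the operator D = q d/dq *)

Lemma cder_fst_ray (f : C -> C) (q l : C) (t : R) :
  cder f (t * q)%C l -> derivable_pt_lim (fun u : R => fst (f (u * q)%C)) t (fst (q * l)%C).
Proof.
  intros [p [H1 [H2 H3]]] e He. pose proof (Cmod_ge_0 q) as Pq.
  destruct (H3 (e / (Cmod q + 1))) as [d [Pd D]]; [apply Rdiv_lt_0_compat; lra|].
  assert (P1 : 0 < d / (Cmod q + 1)) by (apply Rdiv_lt_0_compat; lra).
  exists (mkposreal _ P1). intros h Hh Hd. simpl in Hd.
  assert (Eh : (RtoC (t + h) * q - t * q)%C = (h * q)%C) by (rewrite RtoC_plus; ring).
  assert (X : Cmod ((t + h)%R * q - t * q)%C < d).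
  { rewrite Eh, Cmod_mult, Cmod_R. apply Rlt_div_r in Hd; [|lra].
    pose proof (Rabs_pos h). nra. }
  apply D in X. rewrite H2 in X.
  rewrite (H1 ((t + h)%R * q)%C), Eh.
  set (w := p ((t + h)%R * q)%C) in *.
  replace ((fst (f (t * q) + h * q * w)%C - fst (f (t * q)%C)) / h - fst (q * l)%C)
    with (fst (q * (w - l))%C) by (simpl; field; auto).
  eapply Rle_lt_trans; [apply Rabs_fst_le_Cmod|]. rewrite Cmod_mult.
  apply Rlt_div_r in X; [|lra]. pose proof (Cmod_ge_0 (w - l)). nra.
Qed.

Lemma Cmod_ray (q : C) (t r : R) : 0 <= t <= 1 -> Cmod q < r -> Cmod (t * q) < r.
Proof.
  intros Ht Hq. rewrite Cmod_mult, Cmod_R, Rabs_pos_eq by lra.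
  pose proof (Cmod_ge_0 q). nra.
Qed.

(** D as a relation between a function, a point and a value. At q = 0 the value is always 0 and only
    differentiability is recorded. *)
Definition qder (f : C -> C) (q l : C) : Prop := exists d, cder f q d /\ (q * d)%C = l.

Lemma qder_eq (f : C -> C) (q l m : C) : qder f q l -> l = m -> qder f q m.
Proof. now intros H <-. Qed.

Lemma qder_const (c q : C) : qder (fun _ => c) q 0.
Proof. exists 0; split; [apply cder_const | ring]. Qed.

Lemma qder_plus (f g : C -> C) (q l m : C) :
  qder f q l -> qder g q m -> qder (fun z => f z + g z)%C q (l + m)%C.
Proof.
  intros [d [H1 <-]] [e [H2 <-]]. exists (d + e)%C; split; [now apply cder_plus | ring].
Qed.

Lemma qder_mult (f g : C -> C) (q l m : C) :
  qder f q l -> qder g q m -> qder (fun z => f z * g z)%C q (l * g q + f q * m)%C.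
Proof.
  intros [d [H1 <-]] [e [H2 <-]]. eexists; split; [apply cder_mult; eassumption | ring].
Qed.

Lemma qder_opp (f : C -> C) (q l : C) : qder f q l -> qder (fun z => - f z)%C q (- l)%C.
Proof.
  intros H. pose proof (qder_mult _ _ _ _ _ (qder_const (- (1))%C q) H) as [d [K1 K2]].
  exists d; split.
  - eapply cder_ext; [|exact K1]. intros; simpl; ring.
  - rewrite K2. ring.
Qed.

Lemma qder_minus (f g : C -> C) (q l m : C) :
  qder f q l -> qder g q m -> qder (fun z => f z - g z)%C q (l - m)%C.
Proof. intros H1 H2. apply (qder_plus f (fun z => - g z)%C); auto. now apply qder_opp. Qed.

Lemma qder_comp (f : C -> C) (g : C -> C) (q l m : C) :
  qder g q m -> cder f (g q) l -> qder (fun z => f (g z)) q (l * m)%C.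
Proof.
  intros [d [H1 <-]] H2. eexists; split; [eapply cder_comp; eassumption | ring].
Qed.

Lemma qder_inv (f : C -> C) (q l : C) :
  f q <> 0 -> qder f q l -> qder (fun z => / f z)%C q (- l / (f q * f q))%C.
Proof.
  intros Hn H. eapply qder_eq.
  - apply (qder_comp (fun z => / z)%C f); [eassumption | now apply cder_inv].
  - field; auto.
Qed.

(** The real mean value theorem on the segment from 0 to q. Where t > 0, D f = 0 at tq makes the
    derivative along the segment vanish; at t = 0 continuity suffices. *)
Lemma fst_constant_of_qder_0 (f : C -> C) (r : R) (q : C) :
  (forall z, Cmod z < r -> qder f z 0) -> Cmod q < r -> fst (f q) = fst (f 0).
Proof.
  intros H Hq. destruct (Ceq_dec q 0) as [->|Hn]; [reflexivity|].
  destruct (MVT_gen (fun u : R => fst (f (u * q)%C)) 0 1 (fun _ => 0)) as [c [_ Hc]].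
  - intros t. rewrite Rmin_left, Rmax_right by lra. intros Ht.
    destruct (H (t * q)%C) as [d [H1 H2]]; [apply Cmod_ray; lra|].
    apply is_derive_Reals. replace 0 with (fst (q * d)%C); [now apply cder_fst_ray|].
    assert (E : (t * (q * d))%C = 0) by (rewrite <- H2; ring).
    destruct (Ceq_dec (q * d)%C 0) as [->|N]; [reflexivity|].
    exfalso. revert E. apply Cmult_neq_0; auto. intros E; apply RtoC_inj in E; lra.
  - intros t. rewrite Rmin_left, Rmax_right by lra. intros Ht.
    destruct (H (t * q)%C) as [d [H1 H2]]; [apply Cmod_ray; lra|].
    apply derivable_continuous_pt. eexists. apply cder_fst_ray; eassumption.
  - replace (1%R * q)%C with q in Hc by ring. replace (0%R * q)%C with (RtoC 0) in Hc by ring. lra.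
Qed.

Lemma constant_of_qder_0 (f : C -> C) (r : R) (q : C) :
  (forall z, Cmod z < r -> qder f z 0) -> Cmod q < r -> f q = f 0.
Proof.
  intros H Hq. apply injective_projections.
  - eapply fst_constant_of_qder_0; eauto.
  (* The imaginary part of f is the real part of -i f. *)
  - pose proof (fst_constant_of_qder_0 (fun z => - Ci * f z)%C r q) as K.
    simpl in K.
    assert (E : - 0 * fst (f q) - - (1) * snd (f q) = - 0 * fst (f 0) - - (1) * snd (f 0)).
    { apply K; auto. intros z Hz. eapply qder_eq.
      - apply (qder_mult (fun _ => - Ci)%C f); [apply qder_const | apply H; auto].
      - ring. }
    lra.
Qed.

(** By the intermediate value theorem on the segment from 0 to q, a change of sign would produce a
    zero of the real part. *)
Lemma fst_pos_of_nonzero (f : C -> C) (r : R) (q : C) :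
  (forall z, Cmod z < r -> exists l, qder f z l) ->
  (forall z, Cmod z < r -> fst (f z) <> 0) ->
  0 < fst (f 0) -> Cmod q < r -> 0 < fst (f q).
Proof.
  intros H Hn H0 Hq. destruct (Rlt_le_dec 0 (fst (f q))) as [|L]; auto. exfalso.
  assert (L' : fst (f q) < 0) by (destruct L; auto; now elim (Hn q)).
  destruct (IVT_interv (fun u : R => - fst (f (u * q)%C)) 0 1) as [t [Ht Et]].
  - intros t Ht. apply continuity_pt_opp.
    destruct (H (t * q)%C) as [l [d [H1 _]]]; [now apply Cmod_ray|].
    apply derivable_continuous_pt. eexists. apply cder_fst_ray; eassumption.
  - lra.
  - replace (0%R * q)%C with (RtoC 0) by ring. lra.
  - replace (1%R * q)%C with q by ring. lra.
  - apply (Hn (t * q)%C); [now apply Cmod_ray | lra].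
Qed.

(** * Geometric majorants with polynomial weights, and Taylor bounds for powers *)

Lemma pow_mult_geom_le (k : nat) (rho sigma : R) :
  0 < rho < sigma -> exists K, 0 <= K /\ forall n, INR n ^ k * rho ^ n <= K * sigma ^ n.
Proof.
  revert rho sigma. induction k as [|k IH]; intros rho sigma H.
  - exists 1; split; [lra|]. intros n. rewrite pow_O, !Rmult_1_l. apply pow_incr; lra.
  (* One factor n is absorbed in passing from [tau] to [sigma]: Bernoulli's inequality bounds n by
     (sigma/tau)^n / e. The other k factors are absorbed below [tau] by induction. *)
  - set (tau := (rho + sigma) / 2).
    assert (Ht : rho < tau < sigma) by (unfold tau; lra).
    destruct (IH rho tau) as [K [HK B]]; [lra|].
    set (e := sigma / tau - 1).
    assert (He : 0 < e).
    { unfold e. apply Rlt_0_minus. apply Rlt_div_r; lra. }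
    exists (K / e); split; [apply Rdiv_le_0_compat; auto|]. intros n.
    pose proof (poly n e He) as P.
    assert (Es : sigma ^ n = (1 + e) ^ n * tau ^ n).
    { rewrite <- Rpow_mult_distr. f_equal. unfold e. field. lra. }
    assert (Q : INR n <= (1 + e) ^ n / e) by (apply Rle_div_r; lra).
    pose proof (pos_INR n). assert (0 < tau ^ n) by (apply pow_lt; lra).
    rewrite <- tech_pow_Rmult, Rmult_assoc.
    apply Rle_trans with (INR n * (K * tau ^ n)); [now apply Rmult_le_compat_l|].
    apply Rle_trans with ((1 + e) ^ n / e * (K * tau ^ n)).
    + apply Rmult_le_compat_r; auto. apply Rmult_le_pos; lra.
    + rewrite Es. right. field. lra.
Qed.

Lemma ex_series_geom_scal (K s : R) : 0 <= s < 1 -> ex_series (fun n => K * s ^ n).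
Proof.
  intros H. apply (ex_series_scal (V := R_NormedModule) K (fun n => s ^ n)). apply ex_series_geom. rewrite Rabs_pos_eq; lra.
Qed.

Lemma ex_series_pow_geom (k : nat) (K rho : R) :
  0 <= K -> 0 < rho < 1 -> ex_series (fun n => K * (INR n ^ k * rho ^ n)).
Proof.
  intros HK H. destruct (pow_mult_geom_le k rho ((rho + 1) / 2)) as [K' [HK' B]]; [lra|].
  apply (@ex_series_le R_AbsRing R_CompleteNormedModule _ (fun n => (K * K') * ((rho + 1) / 2) ^ n)).
  - intros n. change (norm (K * (INR n ^ k * rho ^ n))) with (Rabs (K * (INR n ^ k * rho ^ n))).
    rewrite Rabs_pos_eq.
    + rewrite Rmult_assoc. now apply Rmult_le_compat_l.
    + repeat apply Rmult_le_pos; auto; apply pow_le; [apply pos_INR | lra].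
  - apply ex_series_geom_scal; lra.
Qed.

(** The mean value bound n rho^(n-1) |h|, multiplied by rho so that no exponent n - 1 occurs. *)
Lemma Cpow_increment_le (z h : C) (rho : R) (n : nat) :
  Cmod z <= rho -> Cmod (z + h) <= rho ->
  Cmod ((z + h) ^ n - z ^ n)%C * rho <= INR n * rho ^ n * Cmod h.
Proof.
  intros Hz Hw. pose proof (Cmod_ge_0 z). pose proof (Cmod_ge_0 h).
  induction n as [|n IH].
  - simpl. replace (1 - 1)%C with (RtoC 0) by ring. rewrite Cmod_0. lra.
  - replace ((z + h) ^ S n - z ^ S n)%C with ((z + h) * ((z + h) ^ n - z ^ n) + h * z ^ n)%C
      by (simpl; ring).
    pose proof (Cmod_triangle ((z + h) * ((z + h) ^ n - z ^ n)) (h * z ^ n)) as T.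
    rewrite !Cmod_mult, Cmod_pow in T.
    assert (Cmod z ^ n <= rho ^ n) by (apply pow_incr; lra).
    pose proof (Cmod_ge_0 ((z + h) ^ n - z ^ n)).
    assert (Cmod (z + h) * Cmod ((z + h) ^ n - z ^ n) <= rho * Cmod ((z + h) ^ n - z ^ n))
      by (apply Rmult_le_compat_r; lra).
    assert (Cmod h * Cmod z ^ n <= Cmod h * rho ^ n) by (apply Rmult_le_compat_l; lra).
    rewrite S_INR. simpl pow. nra.
Qed.

(** The remainder e_n satisfies e_(n+1) = (z + h) e_n + h^2 n z^(n-1), and n^2 + n <= (n+1)^2 closes
    the induction. The factor rho^2 again avoids exponents below n in the bound. *)
Lemma Cpow_taylor1_le (z h : C) (rho : R) (n : nat) :
  Cmod z <= rho -> Cmod (z + h) <= rho ->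
  Cmod ((z + h) ^ n - z ^ n - h * (INR n * z ^ pred n))%C * rho ^ 2
    <= INR n ^ 2 * rho ^ n * Cmod h ^ 2.
Proof.
  intros Hz Hw. pose proof (Cmod_ge_0 z). pose proof (Cmod_ge_0 h).
  induction n as [|n IH].
  - simpl. replace (1 - 1 - h * (0 * 1))%C with (RtoC 0) by ring. rewrite Cmod_0. lra.
  - set (e := ((z + h) ^ n - z ^ n - h * (INR n * z ^ pred n))%C) in *.
    assert (E : ((z + h) ^ S n - z ^ S n - h * (INR (S n) * z ^ pred (S n)))%C
       = ((z + h) * e + h * h * (INR n * z ^ pred n))%C).
    { unfold e. rewrite S_INR, RtoC_plus. simpl pred. destruct n as [|m].
      - simpl. ring.
      - simpl. ring. }
    rewrite E. pose proof (Cmod_triangle ((z + h) * e) (h * h * (INR n * z ^ pred n))) as T.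
    rewrite !Cmod_mult, Cmod_pow, Cmod_R, (Rabs_pos_eq (INR n)) in T by apply pos_INR.
    pose proof (pos_INR n) as Pn.
    assert (B1 : INR n * Cmod z ^ pred n * rho <= INR n * rho ^ n).
    { destruct n as [|m]; [simpl; lra|]. simpl pred. rewrite Rmult_assoc.
      apply Rmult_le_compat_l; auto. rewrite <- tech_pow_Rmult, (Rmult_comm rho).
      apply Rmult_le_compat_r; [lra|]. apply pow_incr; lra. }
    pose proof (Cmod_ge_0 e).
    assert (B2 : Cmod (z + h) * Cmod e <= rho * Cmod e) by (apply Rmult_le_compat_r; lra).
    assert (0 <= rho) by lra.
    assert (B3 : Cmod h * Cmod h * (INR n * Cmod z ^ pred n) * rho ^ 2
       <= Cmod h ^ 2 * INR n * rho ^ S n).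
    { replace (Cmod h * Cmod h * (INR n * Cmod z ^ pred n) * rho ^ 2)
        with (Cmod h ^ 2 * rho * (INR n * Cmod z ^ pred n * rho)) by ring.
      replace (Cmod h ^ 2 * INR n * rho ^ S n) with (Cmod h ^ 2 * rho * (INR n * rho ^ n)) by (simpl; ring).
      apply Rmult_le_compat_l; auto. apply Rmult_le_pos; auto. apply pow2_ge_0. }
    assert (B4 : rho * Cmod e * rho ^ 2 <= INR n ^ 2 * rho ^ S n * Cmod h ^ 2).
    { replace (INR n ^ 2 * rho ^ S n * Cmod h ^ 2) with (rho * (INR n ^ 2 * rho ^ n * Cmod h ^ 2)) by (simpl; ring).
      rewrite Rmult_assoc. now apply Rmult_le_compat_l. }
    apply Rle_trans with ((Cmod (z + h) * Cmod e + Cmod h * Cmod h * (INR n * Cmod z ^ pred n)) * rho ^ 2).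
    { apply Rmult_le_compat_r; auto. apply pow2_ge_0. }
    rewrite Rmult_plus_distr_r.
    apply Rle_trans with (INR n ^ 2 * rho ^ S n * Cmod h ^ 2 + Cmod h ^ 2 * INR n * rho ^ S n).
    { apply Rplus_le_compat; auto. eapply Rle_trans; [|exact B4].
      apply Rmult_le_compat_r; auto. apply pow2_ge_0. }
    assert (0 <= Cmod h ^ 2 * rho ^ S n) by (apply Rmult_le_pos; [apply pow2_ge_0|now apply pow_le]).
    rewrite S_INR. nra.
Qed.

(** * Lambert series *)

Definition lamb (q : C) (n : nat) : C := (q ^ n / (1 - q ^ n))%C.

Definition Lam (k : nat) (q : C) : C := csum (fun n => RtoC (INR n ^ k) * lamb q n)%C.

(** These sums arise from D L_n = n (L_n + L_n^2); the convolution identities eliminate them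
    again. *)
Definition Lam2 (k : nat) (q : C) : C :=
  csum (fun n => RtoC (INR n ^ k) * (lamb q n * lamb q n))%C.

(* [/ 0 = 0] makes the constant term of a Lambert series vanish. *)
Lemma lamb_0 (q : C) : lamb q 0 = 0.
Proof. apply injective_projections; simpl; unfold Rdiv; ring. Qed.

Lemma Cmod_1_minus_pow_ge (q : C) (rho : R) (n : nat) :
  (0 < n)%nat -> Cmod q <= rho < 1 -> 1 - rho <= Cmod (1 - q ^ n).
Proof.
  intros Hn H. pose proof (Cmod_ge_0 q).
  assert (Cmod (q ^ n) <= rho).
  { rewrite Cmod_pow. destruct n as [|n]; [lia|]. simpl.
    assert (Cmod q ^ n <= 1) by (rewrite <- (pow1 n); apply pow_incr; lra).
    assert (0 <= Cmod q ^ n) by (apply pow_le; lra). nra. }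
  pose proof (Cmod_triangle (1 - q ^ n) (q ^ n)) as T.
  replace (1 - q ^ n + q ^ n)%C with (RtoC 1) in T by ring. rewrite Cmod_1 in T. lra.
Qed.

Lemma one_minus_pow_neq_0 (q : C) (n : nat) :
  (0 < n)%nat -> Cmod q < 1 -> (1 - q ^ n)%C <> 0.
Proof.
  intros Hn H. apply Cmod_gt_0. pose proof (Cmod_1_minus_pow_ge q (Cmod q) n Hn). lra.
Qed.

Lemma Cmod_lamb_le (q : C) (rho : R) (n : nat) :
  Cmod q <= rho < 1 -> Cmod (lamb q n) <= Cmod q ^ n / (1 - rho).
Proof.
  intros H. pose proof (Cmod_ge_0 q). destruct n as [|n].
  - rewrite lamb_0, Cmod_0. apply Rdiv_le_0_compat; simpl; lra.
  - unfold lamb. rewrite Cmod_div by (apply one_minus_pow_neq_0; [lia|lra]).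
    rewrite Cmod_pow. apply Rmult_le_compat_l; [apply pow_le; lra|].
    apply Rinv_le_contravar; [lra|]. apply Cmod_1_minus_pow_ge; [lia|lra].
Qed.

Lemma exists_radius_between (q : C) : Cmod q < 1 -> exists rho, Cmod q < rho < 1 /\ 0 < rho.
Proof. intros H. pose proof (Cmod_ge_0 q). exists ((Cmod q + 1) / 2). lra. Qed.

Lemma lamb_term_geom (q : C) (k : nat) :
  Cmod q < 1 -> exists K s, 0 <= K /\ 0 < s < 1 /\
    forall n, Cmod (RtoC (INR n ^ k) * lamb q n)%C <= K * s ^ n.
Proof.
  intros H. destruct (exists_radius_between q H) as [rho [Hr Hr0]].
  destruct (pow_mult_geom_le k rho ((rho + 1) / 2)) as [K [HK B]]; [lra|].
  exists (K / (1 - rho)), ((rho + 1) / 2).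
  split; [apply Rdiv_le_0_compat; lra|]. split; [lra|]. intros n.
  rewrite Cmod_mult, Cmod_R, Rabs_pos_eq by (apply pow_le, pos_INR).
  eapply Rle_trans.
  { apply Rmult_le_compat_l; [apply pow_le, pos_INR|]. apply (Cmod_lamb_le q rho n). lra. }
  apply Rle_trans with (INR n ^ k * rho ^ n / (1 - rho)).
  - unfold Rdiv. rewrite <- Rmult_assoc. apply Rmult_le_compat_r.
    + left. apply Rinv_0_lt_compat. lra.
    + apply Rmult_le_compat_l; [apply pow_le, pos_INR|]. apply pow_incr. pose proof (Cmod_ge_0 q). lra.
  - replace (K / (1 - rho) * ((rho + 1) / 2) ^ n) with (K * ((rho + 1) / 2) ^ n / (1 - rho)) by (field; lra).
    apply Rmult_le_compat_r; auto. left. apply Rinv_0_lt_compat. lra.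
Qed.

Lemma is_cseries_Lam (k : nat) (q : C) :
  Cmod q < 1 -> is_cseries (fun n => RtoC (INR n ^ k) * lamb q n)%C (Lam k q).
Proof.
  intros H. destruct (lamb_term_geom q k H) as [K [s [HK [Hs B]]]].
  eapply is_cseries_dominated; [exact B|]. apply ex_series_geom_scal; lra.
Qed.

Lemma is_cseries_Lam2 (k : nat) (q : C) :
  Cmod q < 1 -> is_cseries (fun n => RtoC (INR n ^ k) * (lamb q n * lamb q n))%C (Lam2 k q).
Proof.
  intros H. destruct (lamb_term_geom q k H) as [K [s [HK [Hs B]]]].
  apply (is_cseries_dominated _ (fun n => (K * / (1 - Cmod q)) * s ^ n)).
  - intros n. rewrite Cmult_assoc, Cmod_mult.
    pose proof (Cmod_lamb_le q (Cmod q) n ltac:(lra)) as L.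
    assert (Cmod q ^ n <= 1).
    { rewrite <- (pow1 n). apply pow_incr. pose proof (Cmod_ge_0 q). lra. }
    assert (0 < / (1 - Cmod q)) by (apply Rinv_0_lt_compat; lra).
    rewrite Rmult_assoc, (Rmult_comm (/ _)), <- Rmult_assoc.
    apply Rmult_le_compat; auto using Cmod_ge_0. unfold Rdiv in L. nra.
  - apply ex_series_geom_scal; auto; lra.
Qed.

(** The derivative of [lamb q n] with respect to q. *)
Definition lamb' (q : C) (n : nat) : C :=
  (INR n * q ^ pred n / ((1 - q ^ n) * (1 - q ^ n)))%C.

Lemma lamb'_eq (q : C) (n : nat) :
  Cmod q < 1 -> (q * lamb' q n = INR n * (lamb q n + lamb q n * lamb q n))%C.
Proof.
  intros H. destruct n as [|n].
  - unfold lamb'. simpl INR. unfold Cdiv. ring.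
  - unfold lamb', lamb. simpl pred. assert (N := one_minus_pow_neq_0 q (S n) ltac:(lia) H).
    simpl Cpow in *. field. exact N.
Qed.

Lemma Cmod_lamb'_le (q : C) (rho : R) (n : nat) :
  Cmod q <= rho < 1 -> 0 < rho ->
  Cmod (lamb' q n) <= / (rho * (1 - rho) ^ 2) * (INR n * rho ^ n).
Proof.
  intros H H0. pose proof (Cmod_ge_0 q). destruct n as [|n].
  - unfold lamb'. simpl INR. unfold Cdiv. rewrite !Cmult_0_l, Cmod_0. lra.
  - unfold lamb'. simpl pred.
    assert (N := one_minus_pow_neq_0 q (S n) ltac:(lia) ltac:(lra)).
    assert (B := Cmod_1_minus_pow_ge q rho (S n) ltac:(lia) H).
    rewrite Cmod_div by (now apply Cmult_neq_0).
    rewrite !Cmod_mult, Cmod_R, Rabs_pos_eq by apply pos_INR.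
    rewrite Cmod_pow.
    assert (Hd : (1 - rho) ^ 2 <= Cmod (1 - q ^ S n) * Cmod (1 - q ^ S n)) by nra.
    assert (P2 : 0 < (1 - rho) ^ 2) by (apply pow_lt; lra).
    apply Rle_trans with (INR (S n) * rho ^ n / (1 - rho) ^ 2).
    + apply Rmult_le_compat.
      * apply Rmult_le_pos; [apply pos_INR|]. now apply pow_le.
      * left. apply Rinv_0_lt_compat. lra.
      * apply Rmult_le_compat_l; [apply pos_INR|]. apply pow_incr; lra.
      * now apply Rinv_le_contravar.
    + right. change (rho ^ S n) with (rho * rho ^ n). field. lra.
Qed.

Lemma lamb_taylor1_le (q h : C) (rho : R) (n : nat) :
  0 < rho < 1 -> Cmod q <= rho -> Cmod (q + h) <= rho ->
  Cmod (lamb (q + h) n - lamb q n - h * lamb' q n)%C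
    <= 2 / (rho ^ 2 * (1 - rho) ^ 3) * (INR n ^ 2 * rho ^ n) * Cmod h ^ 2.
Proof.
  intros Hr Hq Hw. pose proof (Cmod_ge_0 q) as Pq.
  pose proof (Cmod_ge_0 h) as Ph.
  destruct (Nat.eq_dec n 0) as [->|Hn].
  { rewrite !lamb_0. unfold lamb', Cdiv. simpl INR. rewrite !Cmult_0_l, Cmult_0_r.
    replace (0 - 0 - 0)%C with (RtoC 0) by ring. rewrite Cmod_0. rewrite pow_ne_zero by lia. lra. }
  assert (N1 := one_minus_pow_neq_0 q n ltac:(lia) ltac:(lra)).
  assert (N2 := one_minus_pow_neq_0 (q + h) n ltac:(lia) ltac:(lra)).
  assert (B1 := Cmod_1_minus_pow_ge q rho n ltac:(lia) ltac:(lra)).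
  assert (B2 := Cmod_1_minus_pow_ge (q + h) rho n ltac:(lia) ltac:(lra)).
  assert (T0 := Cpow_increment_le q h rho n Hq Hw).
  assert (T1 := Cpow_taylor1_le q h rho n Hq Hw).
  set (e := ((q + h) ^ n - q ^ n - h * (INR n * q ^ pred n))%C) in *.
  set (u := ((q + h) ^ n - q ^ n)%C) in *.
  set (d := (1 - q ^ n)%C) in *. set (d' := (1 - (q + h) ^ n)%C) in *.
  (* Exact form of the remainder, from L_n = 1/d - 1. Both terms of the numerator are of order
     |h|^2: [e] by the second-order bound, [u * u] by the first-order one. *)
  assert (E : (lamb (q + h) n - lamb q n - h * lamb' q n)%C = ((e * d' + u * u) / (d * d * d'))%C).
  { unfold lamb, lamb'. fold d d'.
    assert (Ed : (q ^ n)%C = (1 - d)%C) by (unfold d; ring).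
    assert (Ed' : ((q + h) ^ n)%C = (1 - d')%C) by (unfold d'; ring).
    unfold e, u. rewrite Ed, Ed'. field. auto. }
  rewrite E. rewrite Cmod_div by (repeat apply Cmult_neq_0; auto). rewrite !Cmod_mult.
  set (X := INR n ^ 2 * rho ^ n * Cmod h ^ 2) in *.
  assert (HX : 0 <= X).
  { unfold X. apply Rmult_le_pos; [apply Rmult_le_pos|]; try apply pow2_ge_0. apply pow_le; lra. }
  assert (Hrn : 0 < rho ^ n <= 1).
  { split; [apply pow_lt; lra|]. rewrite <- (pow1 n). apply pow_incr; lra. }
  assert (U2 : Cmod u * Cmod u * rho ^ 2 <= X).
  { apply Rle_trans with ((INR n * rho ^ n * Cmod h) * (INR n * rho ^ n * Cmod h)).
    - replace (Cmod u * Cmod u * rho ^ 2) with ((Cmod u * rho) * (Cmod u * rho)) by ring.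
      assert (0 <= Cmod u * rho) by (apply Rmult_le_pos; [apply Cmod_ge_0|lra]).
      apply Rmult_le_compat; auto.
    - replace ((INR n * rho ^ n * Cmod h) * (INR n * rho ^ n * Cmod h)) with (rho ^ n * X) by (unfold X; ring).
      nra. }
  assert (Hd' : Cmod d' <= 2).
  { unfold d', Cminus. eapply Rle_trans; [apply Cmod_triangle|].
    rewrite Cmod_opp, Cmod_1, Cmod_pow.
    assert (Cmod (q + h) ^ n <= 1); [|lra].
    rewrite <- (pow1 n). apply pow_incr. split; [apply Cmod_ge_0|lra]. }
  assert (P3 : 0 < (1 - rho) ^ 3) by (apply pow_lt; lra).
  assert (P2 : 0 < rho ^ 2) by (apply pow_lt; lra).
  assert (Pd : 0 < Cmod d) by lra. assert (Pd' : 0 < Cmod d') by lra.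
  apply Rle_div_l; [repeat apply Rmult_lt_0_compat; auto|].
  eapply Rle_trans; [apply Cmod_triangle|]. rewrite !Cmod_mult.
  assert (A1 : Cmod e <= X / rho ^ 2) by (apply Rle_div_r; lra).
  assert (A2 : Cmod u * Cmod u <= X / rho ^ 2) by (apply (proj1 (Rle_div_r _ _ _ P2)); exact U2).
  assert (HXr : 0 <= X / rho ^ 2) by (apply Rdiv_le_0_compat; auto).
  set (Y := X / rho ^ 2) in *.
  replace (2 / (rho ^ 2 * (1 - rho) ^ 3) * (INR n ^ 2 * rho ^ n) * Cmod h ^ 2)
    with (Y * 2 / (1 - rho) ^ 3) by (unfold Y, X; field; lra).
  assert (Hm : (1 - rho) ^ 2 * Cmod d' <= Cmod d * Cmod d * Cmod d').
  { apply Rmult_le_compat_r; [lra|]. simpl. nra. }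
  apply Rle_trans with (Y * 2 / (1 - rho) ^ 3 * ((1 - rho) ^ 2 * Cmod d')).
  2:{ apply Rmult_le_compat_l; [apply Rdiv_le_0_compat; lra | exact Hm]. }
  replace (Y * 2 / (1 - rho) ^ 3 * ((1 - rho) ^ 2 * Cmod d')) with (Y * (2 * Cmod d' / (1 - rho))) by (field; lra).
  assert (A3 : Cmod e * Cmod d' <= Y * Cmod d') by (apply Rmult_le_compat_r; lra).
  (* This uses 1 - rho <= |d'| to absorb the summand 1, which comes from [u * u]. *)
  assert (A4 : Cmod d' + 1 <= 2 * Cmod d' / (1 - rho)).
  { apply Rle_div_r; [lra|]. nra. }
  apply Rle_trans with (Y * (Cmod d' + 1)); [lra|]. now apply Rmult_le_compat_l.
Qed.

Lemma qder_Lam (k : nat) (q : C) :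
  Cmod q < 1 -> qder (Lam k) q (Lam (S k) q + Lam2 (S k) q)%C.
Proof.
  intros H. destruct (exists_radius_between q H) as [rho [Hr Hr0]].
  assert (G : is_cseries (fun n => RtoC (INR n ^ k) * lamb' q n)%C
                (csum (fun n => RtoC (INR n ^ k) * lamb' q n)%C)).
  { apply (is_cseries_dominated _ (fun n => / (rho * (1 - rho) ^ 2) * (INR n ^ S k * rho ^ n))).
    - intros n. rewrite Cmod_mult, Cmod_R, Rabs_pos_eq by (apply pow_le, pos_INR).
      eapply Rle_trans.
      { apply Rmult_le_compat_l; [apply pow_le, pos_INR|].
        apply (Cmod_lamb'_le q rho n); lra. }
      right. change (INR n ^ S k) with (INR n * INR n ^ k). ring.
    - apply ex_series_pow_geom; [|lra]. left. apply Rinv_0_lt_compat.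
      apply Rmult_lt_0_compat; auto. apply pow_lt; lra. }
  eexists. split.
  - apply (cder_cseries (fun n z => RtoC (INR n ^ k) * lamb z n)%C (Lam k)
      (* Increments shorter than rho - |q| stay in the disc of radius rho, where the majorants
         hold. *)
      (fun n => RtoC (INR n ^ k) * lamb' q n)%C _ q (rho - Cmod q)
      (fun n => 2 / (rho ^ 2 * (1 - rho) ^ 3) * (INR n ^ (k + 2) * rho ^ n))); [lra| | |exact G|].
    + apply ex_series_pow_geom; [|lra]. apply Rdiv_le_0_compat; [lra|].
      apply Rmult_lt_0_compat; apply pow_lt; lra.
    + intros h Hh. apply is_cseries_Lam. pose proof (Cmod_triangle q h). lra.
    + intros n h Hh. pose proof (Cmod_triangle q h).
      replace (RtoC (INR n ^ k) * lamb (q + h) n - RtoC (INR n ^ k) * lamb q n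
         - h * (RtoC (INR n ^ k) * lamb' q n))%C
        with (RtoC (INR n ^ k) * (lamb (q + h) n - lamb q n - h * lamb' q n))%C by ring.
      rewrite Cmod_mult, Cmod_R, Rabs_pos_eq by (apply pow_le, pos_INR).
      eapply Rle_trans.
      { apply Rmult_le_compat_l; [apply pow_le, pos_INR|].
        apply (lamb_taylor1_le q h rho n); lra. }
      right. rewrite pow_add. ring.
  - rewrite <- (is_cseries_unique _ _ (is_cseries_scal q _ _ G)). apply is_cseries_unique.
    eapply is_cseries_ext; [|apply is_cseries_plus; [apply is_cseries_Lam|apply is_cseries_Lam2]; exact H].
    intros n. simpl. rewrite RtoC_mult.
    replace (q * (RtoC (INR n ^ k) * lamb' q n))%C with (RtoC (INR n ^ k) * (q * lamb' q n))%C by ring.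
    rewrite lamb'_eq by exact H. ring.
Qed.

Lemma lamb_at_0 (n : nat) : lamb 0 n = 0.
Proof. destruct n as [|n]; [apply lamb_0 | unfold lamb, Cdiv; simpl Cpow; ring]. Qed.

Lemma Lam_0 (k : nat) : Lam k 0 = 0.
Proof.
  assert (H : Cmod 0 < 1) by (rewrite Cmod_0; lra).
  (* Every term is 0, so the series is also 0 times itself. *)
  transitivity (0 * Lam k 0)%C; [|ring]. apply is_cseries_unique.
  eapply is_cseries_ext; [|apply is_cseries_scal, is_cseries_Lam; exact H].
  intros n. rewrite lamb_at_0. simpl. ring.
Qed.

(** With x = q^a and y = q^b one has 1 + L_a + L_b = (1 - xy) / ((1 - x)(1 - y)). *)
Lemma lamb_mult (q : C) (a b : nat) :
  Cmod q < 1 -> (0 < a)%nat -> (0 < b)%nat ->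
  (lamb q a * lamb q b = lamb q (a + b) * (1 + lamb q a + lamb q b))%C.
Proof.
  intros H Ha Hb. unfold lamb.
  assert (N1 := one_minus_pow_neq_0 q a Ha H).
  assert (N2 := one_minus_pow_neq_0 q b Hb H).
  assert (N3 := one_minus_pow_neq_0 q (a + b) ltac:(lia) H).
  rewrite Cpow_add_r in *. field. auto.
Qed.

(** * Convolutions of Lambert series *)

(** The upper index is included, as in [sum_f_R0] and [Cpartial]. *)
Fixpoint csumn (f : nat -> C) (n : nat) : C :=
  match n with O => f O | S m => (csumn f m + f (S m))%C end.

Definition clim (u : nat -> C) (l : C) : Prop :=
  is_lim_seq (fun n => fst (u n)) (fst l) /\ is_lim_seq (fun n => snd (u n)) (snd l).

Lemma csumn_ext (f g : nat -> C) (n : nat) :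
  (forall i, (i <= n)%nat -> f i = g i) -> csumn f n = csumn g n.
Proof.
  induction n as [|n IH]; intros H; simpl.
  - apply H; lia.
  - rewrite IH by (intros; apply H; lia). rewrite H by lia. reflexivity.
Qed.

Lemma csumn_plus (f g : nat -> C) (n : nat) :
  csumn (fun i => f i + g i)%C n = (csumn f n + csumn g n)%C.
Proof. induction n as [|n IH]; simpl; [reflexivity|]. rewrite IH. ring. Qed.

Lemma csumn_scal (c : C) (f : nat -> C) (n : nat) :
  csumn (fun i => c * f i)%C n = (c * csumn f n)%C.
Proof. induction n as [|n IH]; simpl; [reflexivity|]. rewrite IH. ring. Qed.

Lemma csumn_shift (f : nat -> C) (n : nat) :
  csumn f (S n) = (f O + csumn (fun i => f (S i)) n)%C.
Proof. induction n as [|n IH]; [reflexivity|]. simpl in *. rewrite IH. ring. Qed.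

Lemma csumn_rev (f : nat -> C) (n : nat) : csumn f n = csumn (fun i => f (n - i)%nat) n.
Proof.
  induction n as [|n IH]; [reflexivity|].
  rewrite (csumn_shift (fun i => f (S n - i)%nat)). simpl. rewrite IH, Cplus_comm. reflexivity.
Qed.

Lemma csumn_RtoC (f : nat -> R) (n : nat) :
  csumn (fun i => RtoC (f i)) n = RtoC (sum_f_R0 f n).
Proof. induction n as [|n IH]; simpl; [reflexivity|]. now rewrite IH, RtoC_plus. Qed.

Lemma fst_csumn (f : nat -> C) (n : nat) : fst (csumn f n) = sum_f_R0 (fun i => fst (f i)) n.
Proof. induction n as [|n IH]; simpl; [reflexivity|]. now rewrite IH. Qed.

Lemma snd_csumn (f : nat -> C) (n : nat) : snd (csumn f n) = sum_f_R0 (fun i => snd (f i)) n.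
Proof. induction n as [|n IH]; simpl; [reflexivity|]. now rewrite IH. Qed.

Lemma is_series_lim (a : nat -> R) (l : R) : is_series a l <-> is_lim_seq (sum_f_R0 a) l.
Proof.
  split; intros H.
  - apply is_lim_seq_ext with (sum_n a); [intros n; apply sum_n_Reals | exact H].
  - apply (is_lim_seq_ext (sum_f_R0 a) (sum_n a) l); [|exact H].
    intros n; symmetry; apply sum_n_Reals.
Qed.

Lemma clim_ext (u v : nat -> C) (l : C) : (forall n, u n = v n) -> clim u l -> clim v l.
Proof.
  intros E [H1 H2]; split; eapply is_lim_seq_ext; try eassumption; intros n; simpl; now rewrite E.
Qed.

Lemma is_cseries_clim (f : nat -> C) (l : C) : is_cseries f l <-> clim (csumn f) l.
Proof.
  split; intros [H1 H2]; split.
  - apply is_series_lim in H1. eapply is_lim_seq_ext; [|exact H1]. intros n; cbv beta; rewrite fst_csumn; reflexivity.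
  - apply is_series_lim in H2. eapply is_lim_seq_ext; [|exact H2]. intros n; cbv beta; rewrite snd_csumn; reflexivity.
  - apply is_series_lim. eapply is_lim_seq_ext; [|exact H1]. intros n; cbv beta; rewrite fst_csumn; reflexivity.
  - apply is_series_lim. eapply is_lim_seq_ext; [|exact H2]. intros n; cbv beta; rewrite snd_csumn; reflexivity.
Qed.

Lemma clim_unique (u : nat -> C) (l m : C) : clim u l -> clim u m -> l = m.
Proof.
  intros [H1 H2] [H3 H4]. apply injective_projections.
  - apply is_lim_seq_unique in H1, H3. congruence.
  - apply is_lim_seq_unique in H2, H4. congruence.
Qed.

Lemma clim_plus (u v : nat -> C) (l m : C) :
  clim u l -> clim v m -> clim (fun n => u n + v n)%C (l + m)%C.
Proof. intros [H1 H2] [H3 H4]; split; apply is_lim_seq_plus'; assumption. Qed.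

Lemma clim_mult (u v : nat -> C) (l m : C) :
  clim u l -> clim v m -> clim (fun n => u n * v n)%C (l * m)%C.
Proof.
  intros [H1 H2] [H3 H4]; split.
  - apply is_lim_seq_minus'; apply is_lim_seq_mult'; assumption.
  - apply is_lim_seq_plus'; apply is_lim_seq_mult'; assumption.
Qed.

Lemma clim_const (c : C) : clim (fun _ => c) c.
Proof. split; apply is_lim_seq_const. Qed.

Definition square_sum (F : nat -> nat -> C) (N : nat) : C :=
  csumn (fun a => csumn (F a) N) N.

(** Truncation of a double series at a + b <= N, the order of the Cauchy product. *)
Definition triangle_sum (F : nat -> nat -> C) (N : nat) : C :=
  csumn (fun c => csumn (fun a => F a (c - a)%nat) c) N.

(** The geometric bounds make all four component series absolutely convergent, and the real Cauchy
    product theorem applies to each pair. *)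
Lemma cauchy_product (f g : nat -> C) (l m : C) (K L s t : R) :
  0 <= s < 1 -> 0 <= t < 1 ->
  (forall n, Cmod (f n) <= K * s ^ n) -> (forall n, Cmod (g n) <= L * t ^ n) ->
  is_cseries f l -> is_cseries g m ->
  clim (triangle_sum (fun a b => f a * g b)%C) (l * m)%C.
Proof.
  intros Hs Ht Bf Bg [F1 F2] [G1 G2].
  assert (dom : forall (u : nat -> R) (v : nat -> C) (M r : R), 0 <= r < 1 ->
     (forall n, Rabs (u n) <= Cmod (v n)) -> (forall n, Cmod (v n) <= M * r ^ n) ->
     ex_series (fun n => Rabs (u n))).
  { intros u v M r Hr H1 H2.
    apply (@ex_series_le R_AbsRing R_CompleteNormedModule _ (fun n => M * r ^ n)).
    - intros n. change (norm (Rabs (u n))) with (Rabs (Rabs (u n))). rewrite Rabs_Rabsolu.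
      eapply Rle_trans; eauto.
    - now apply ex_series_geom_scal. }
  assert (Af1 := dom _ f K s Hs (fun n => Rabs_fst_le_Cmod (f n)) Bf).
  assert (Af2 := dom _ f K s Hs (fun n => Rabs_snd_le_Cmod (f n)) Bf).
  assert (Ag1 := dom _ g L t Ht (fun n => Rabs_fst_le_Cmod (g n)) Bg).
  assert (Ag2 := dom _ g L t Ht (fun n => Rabs_snd_le_Cmod (g n)) Bg).
  apply is_cseries_clim. split.
  - eapply is_series_ext;
      [|exact (is_series_minus _ _ _ _ (is_series_mult _ _ _ _ F1 G1 Af1 Ag1)
                                       (is_series_mult _ _ _ _ F2 G2 Af2 Ag2))].
    intros n. cbv beta. rewrite fst_csumn. symmetry. apply minus_sum.
  - eapply is_series_ext;
      [|exact (is_series_plus _ _ _ _ (is_series_mult _ _ _ _ F1 G2 Af1 Ag2)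
                                      (is_series_mult _ _ _ _ F2 G1 Af2 Ag1))].
    intros n. cbv beta. rewrite snd_csumn. symmetry. apply plus_sum.
Qed.

Lemma square_sum_prod (f g : nat -> C) (N : nat) :
  square_sum (fun a b => f a * g b)%C N = (csumn f N * csumn g N)%C.
Proof.
  unfold square_sum. rewrite (csumn_ext _ (fun a => csumn g N * f a)%C).
  - rewrite csumn_scal. ring.
  - intros i _. rewrite csumn_scal. ring.
Qed.

(** By symmetry, two copies of the lower triangle cover the square and count the diagonal twice. *)
Lemma square_sum_sym (F : nat -> nat -> C) (N : nat) :
  (forall a b, F a b = F b a) ->
  (square_sum F N + csumn (fun c => F c c) N)%C = (2 * csumn (fun c => csumn (F c) c) N)%C.
Proof.
  intros Hs. induction N as [|N IH].
  - unfold square_sum; simpl. ring.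
  - assert (E : square_sum F (S N) = (square_sum F N + 2 * csumn (F (S N)) N + F (S N) (S N))%C).
    { unfold square_sum. cbn [csumn]. rewrite csumn_plus.
      rewrite (csumn_ext (fun i => F i (S N)) (F (S N))) by (intros; apply Hs). ring. }
    rewrite E. cbn [csumn].
    transitivity (square_sum F N + csumn (fun c => F c c) N + 2 * csumn (F (S N)) N + 2 * F (S N) (S N))%C;
      [ring|]. rewrite IH. ring.
Qed.

(* Along a + b = c the relation [lamb_mult] linearises the product; the terms a = 0 and a = c,
   where it fails, are removed by hand. *)
Lemma antidiagonal_sum (q : C) (H : R -> R -> R) (c : nat) :
  Cmod q < 1 -> (forall x y, H x y = H y x) ->
  csumn (fun a => RtoC (H (INR a) (INR (c - a))) * (lamb q a * lamb q (c - a)))%C c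
  = (RtoC (sum_f_R0 (fun a => H (INR a) (INR c - INR a)%R) c) * lamb q c
     + 2 * csumn (fun b => RtoC (H (INR c - INR b)%R (INR b)) * (lamb q c * lamb q b)) c
     - 2 * RtoC (H 0%R (INR c)) * (lamb q c + lamb q c * lamb q c))%C.
Proof.
  intros Hq Hs. destruct c as [|c].
  { simpl. rewrite !lamb_0. ring. }
  set (k := fun a => (RtoC (H (INR a) (INR (S c - a))) * (lamb q (S c) * (1 + lamb q a + lamb q (S c - a))))%C).
  assert (E : csumn (fun a => RtoC (H (INR a) (INR (S c - a))) * (lamb q a * lamb q (S c - a)))%C (S c)
     = (csumn k (S c) - k O - k (S c))%C).
  { rewrite !csumn_shift. destruct c as [|c].
    - simpl csumn. unfold k. rewrite !Nat.sub_diag, !Nat.sub_0_r, !lamb_0. ring.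
    - cbn [csumn]. rewrite (csumn_ext _ (fun i => k (S i))).
      + unfold k. rewrite !Nat.sub_diag, !Nat.sub_0_r, !lamb_0. ring.
      + intros i Hi. unfold k. rewrite lamb_mult by (try assumption; lia).
        replace (S i + (S (S c) - S i))%nat with (S (S c)) by lia. reflexivity. }
  rewrite E.
  set (g := fun a => (RtoC (H (INR (S c) - INR a)%R (INR a)) * (lamb q (S c) * lamb q a))%C).
  assert (E2 : csumn k (S c)
     = (RtoC (sum_f_R0 (fun a => H (INR a) (INR (S c) - INR a)%R) (S c)) * lamb q (S c)
        + (csumn g (S c) + csumn (fun a => g (S c - a)%nat) (S c)))%C).
  { rewrite <- csumn_RtoC, Cmult_comm, <- csumn_scal, <- !csumn_plus. apply csumn_ext.
    intros i Hi. unfold k, g. rewrite !minus_INR by lia.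
    replace (INR (S c) - (INR (S c) - INR i)%R) with (INR i) by ring.
    rewrite (Hs (INR (S c) - INR i)%R (INR i)). ring. }
  rewrite E2, <- csumn_rev. unfold k. rewrite !Nat.sub_diag, !Nat.sub_0_r, !lamb_0.
  change (INR 0) with 0. rewrite (Hs (INR (S c)) 0). ring.
Qed.

(** An exact identity for every N. Summed over a + b = c, the weight H(a,b) yields linear terms and
    twice a row with weight H(c-b,b), b <= c. By symmetry the two square sums are twice their lower
    triangles up to diagonals, and their difference cancels these rows. The bracket of triangle
    minus square is kept because it disappears in the limit. *)
Lemma lambert_truncated_identity (q : C) (H : R -> R -> R) (N : nat) :
  Cmod q < 1 -> (forall x y, H x y = H y x) ->
  (forall x y, H x y - H (x - y) y = H y x - H (y - x) x) ->
  (square_sum (fun a b => RtoC (H (INR a) (INR b) - H (INR a - INR b)%R (INR b)) * (lamb q a * lamb q b)) N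
   + (triangle_sum (fun a b => RtoC (H (INR a) (INR b)) * (lamb q a * lamb q b)) N
      - square_sum (fun a b => RtoC (H (INR a) (INR b)) * (lamb q a * lamb q b)) N))%C
  = csumn (fun c => RtoC (sum_f_R0 (fun a => H (INR a) (INR c - INR a)%R) c - 2 * H 0%R (INR c)) * lamb q c
                    - RtoC (H 0%R (INR c)) * (lamb q c * lamb q c))%C N.
Proof.
  intros Hq Hs Hg.
  set (F := fun a b => (RtoC (H (INR a) (INR b)) * (lamb q a * lamb q b))%C).
  set (G := fun a b => (RtoC (H (INR a) (INR b) - H (INR a - INR b)%R (INR b)) * (lamb q a * lamb q b))%C).
  set (D := fun a b => (RtoC (H (INR a - INR b)%R (INR b)) * (lamb q a * lamb q b))%C).
  assert (SF := square_sum_sym F N). assert (SG := square_sum_sym G N).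
  assert (EG : forall a b, G a b = (F a b + (- (1)) * D a b)%C).
  { intros a b. unfold G, F, D. rewrite RtoC_minus. ring. }
  assert (LG : csumn (fun c => csumn (G c) c) N
     = (csumn (fun c => csumn (F c) c) N - csumn (fun c => csumn (D c) c) N)%C).
  { rewrite (csumn_ext _ (fun c => csumn (F c) c + (- (1)) * csumn (D c) c)%C).
    - rewrite csumn_plus, csumn_scal. ring.
    - intros c _. rewrite (csumn_ext _ (fun b => F c b + (- (1)) * D c b)%C) by (intros; apply EG).
      now rewrite csumn_plus, csumn_scal. }
  assert (DG : csumn (fun c => G c c) N = (csumn (fun c => F c c) N - csumn (fun c => D c c) N)%C).
  { rewrite (csumn_ext _ (fun c => F c c + (- (1)) * D c c)%C) by (intros; apply EG).
    rewrite csumn_plus, csumn_scal. ring. }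
  rewrite LG, DG in SG.
  assert (SF' := SF ltac:(intros a b; unfold F; rewrite Hs; ring)).
  assert (SG' := SG ltac:(intros a b; unfold G; rewrite Hg; ring)).
  assert (T : triangle_sum F N = (csumn (fun c =>
      RtoC (sum_f_R0 (fun a => H (INR a) (INR c - INR a)%R) c - 2 * H 0%R (INR c)) * lamb q c
                    - RtoC (H 0%R (INR c)) * (lamb q c * lamb q c)) N
      + (2 * csumn (fun c => csumn (D c) c) N + (- (1)) * csumn (fun c => D c c) N))%C).
  { unfold triangle_sum. rewrite <- !csumn_scal, <- !csumn_plus. apply csumn_ext. intros c _.
    unfold F. rewrite antidiagonal_sum by assumption. fold (D c). unfold D at 3.
    change (csumn (fun b => RtoC (H (INR c - INR b)%R (INR b)) * (lamb q c * lamb q b))%C c) with (csumn (D c) c).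
    rewrite Rminus_diag, !RtoC_minus, !RtoC_mult. ring. }
  rewrite T.
  transitivity (square_sum G N + (csumn (fun c => F c c) N - csumn (fun c => D c c) N)
    - (square_sum F N + csumn (fun c => F c c) N) + csumn (fun c =>
      RtoC (sum_f_R0 (fun a => H (INR a) (INR c - INR a)%R) c - 2 * H 0%R (INR c)) * lamb q c
                    - RtoC (H 0%R (INR c)) * (lamb q c * lamb q c)) N
     + 2 * csumn (fun c => csumn (D c) c) N)%C; [ring|].
  rewrite SG', SF'. ring.
Qed.

Definition lterm (q : C) (k n : nat) : C := (RtoC (INR n ^ k) * lamb q n)%C.

(** Both ways of truncating the double series lead to the same value. *)
Definition double_lim (F : nat -> nat -> C) (l : C) : Prop :=
  clim (square_sum F) l /\ clim (triangle_sum F) l.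

Lemma double_lim_ext (F G : nat -> nat -> C) (l : C) :
  (forall a b, F a b = G a b) -> double_lim F l -> double_lim G l.
Proof.
  intros E [H1 H2]; split; [eapply clim_ext; [|exact H1] | eapply clim_ext; [|exact H2]];
    intros n; unfold square_sum, triangle_sum;
    apply csumn_ext; intros i _; cbv beta; apply csumn_ext; intros; apply E.
Qed.

Lemma double_lim_plus (F G : nat -> nat -> C) (l m : C) :
  double_lim F l -> double_lim G m -> double_lim (fun a b => F a b + G a b)%C (l + m)%C.
Proof.
  intros [H1 H2] [H3 H4]; split.
  - eapply clim_ext; [|exact (clim_plus _ _ _ _ H1 H3)]. intros n.
    unfold square_sum. cbv beta. rewrite <- csumn_plus. apply csumn_ext. intros. now rewrite csumn_plus.
  - eapply clim_ext; [|exact (clim_plus _ _ _ _ H2 H4)]. intros n.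
    unfold triangle_sum. cbv beta. rewrite <- csumn_plus. apply csumn_ext. intros. now rewrite csumn_plus.
Qed.

Lemma double_lim_scal (c : C) (F : nat -> nat -> C) (l : C) :
  double_lim F l -> double_lim (fun a b => c * F a b)%C (c * l)%C.
Proof.
  intros [H1 H2]; split.
  - eapply clim_ext; [|exact (clim_mult _ _ _ _ (clim_const c) H1)]. intros n.
    unfold square_sum. cbv beta. rewrite <- csumn_scal. apply csumn_ext. intros. now rewrite csumn_scal.
  - eapply clim_ext; [|exact (clim_mult _ _ _ _ (clim_const c) H2)]. intros n.
    unfold triangle_sum. cbv beta. rewrite <- csumn_scal. apply csumn_ext. intros. now rewrite csumn_scal.
Qed.

Lemma double_lim_lterm (q : C) (i j : nat) :
  Cmod q < 1 -> double_lim (fun a b => lterm q i a * lterm q j b)%C (Lam i q * Lam j q)%C.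
Proof.
  intros Hq. destruct (lamb_term_geom q i Hq) as [K [s [_ [Hs B]]]].
  destruct (lamb_term_geom q j Hq) as [K' [s' [_ [Hs' B']]]].
  assert (I := is_cseries_Lam i q Hq). assert (J := is_cseries_Lam j q Hq). split.
  - eapply clim_ext; [intros n; symmetry; apply square_sum_prod|].
    apply clim_mult; apply is_cseries_clim; assumption.
  - apply cauchy_product with K K' s s'; auto; lra.
Qed.

(** As N grows, the triangle and square sums with weight H both tend to [lH] and cancel. *)
Lemma lambert_convolution (q : C) (H : R -> R -> R) (lH lG r : C) :
  Cmod q < 1 -> (forall x y, H x y = H y x) ->
  (forall x y, H x y - H (x - y) y = H y x - H (y - x) x) ->
  double_lim (fun a b => RtoC (H (INR a) (INR b)) * (lamb q a * lamb q b))%C lH ->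
  double_lim (fun a b => RtoC (H (INR a) (INR b) - H (INR a - INR b)%R (INR b)) * (lamb q a * lamb q b))%C lG ->
  is_cseries (fun c => RtoC (sum_f_R0 (fun a => H (INR a) (INR c - INR a)%R) c - 2 * H 0%R (INR c)) * lamb q c
                    - RtoC (H 0%R (INR c)) * (lamb q c * lamb q c))%C r ->
  lG = r.
Proof.
  intros Hq Hs Hg [H1 H2] [H3 _] H4. apply is_cseries_clim in H4.
  eapply clim_unique; [|exact H4].
  eapply clim_ext; [intros n; exact (lambert_truncated_identity q H n Hq Hs Hg)|].
  replace lG with (lG + (lH + (- (1)) * lH))%C by ring.
  apply clim_plus; [exact H3|].
  eapply clim_ext; [|apply clim_plus; [exact H2|exact (clim_mult _ _ _ _ (clim_const (- (1))%C) H1)]].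
  intros n. cbv beta. ring.
Qed.


(** * Convolution identities for polynomial weights *)

Fixpoint poly1 (p : list (R * nat)) (x : R) : R :=
  match p with
  | nil => 0
  | cons (c, k) p' => c * x ^ k + poly1 p' x
  end.

Fixpoint poly2 (p : list (R * nat * nat)) (x y : R) : R :=
  match p with
  | nil => 0
  | cons (c, i, j) p' => c * (x ^ i * y ^ j) + poly2 p' x y
  end.

(** Polynomials are lists of monomials so that summing against L_n becomes a recursion on the list:
    x^k turns into [Lam k], and in [lambert2] x^i y^j turns into [Lam i * Lam j]. *)
Fixpoint lambert1 (p : list (R * nat)) (q : C) : C :=
  match p with
  | nil => 0
  | cons (c, k) p' => (c * Lam k q + lambert1 p' q)%C
  end.

Fixpoint lambert2 (p : list (R * nat * nat)) (q : C) : C :=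
  match p with
  | nil => 0
  | cons (c, i, j) p' => (c * (Lam i q * Lam j q) + lambert2 p' q)%C
  end.

Lemma double_lim_poly2 (q : C) (p : list (R * nat * nat)) :
  Cmod q < 1 ->
  double_lim (fun a b => RtoC (poly2 p (INR a) (INR b)) * (lamb q a * lamb q b))%C (lambert2 p q).
Proof.
  intros Hq. induction p as [|[[c i] j] p IH].
  - simpl. replace (RtoC 0) with (0 * (Lam 0 q * Lam 0 q))%C by ring.
    eapply double_lim_ext; [|exact (double_lim_scal 0 _ _ (double_lim_lterm q 0 0 Hq))].
    intros a b. simpl. ring.
  - eapply double_lim_ext;
      [|exact (double_lim_plus _ _ _ _ (double_lim_scal (RtoC c) _ _ (double_lim_lterm q i j Hq)) IH)].
    intros a b. simpl poly2. unfold lterm. cbv beta. rewrite RtoC_plus, !RtoC_mult. ring.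
Qed.

Lemma is_cseries_poly1 (q : C) (p : list (R * nat)) :
  Cmod q < 1 -> is_cseries (fun c => RtoC (poly1 p (INR c)) * lamb q c)%C (lambert1 p q).
Proof.
  intros Hq. induction p as [|[c k] p IH].
  - simpl. replace (RtoC 0) with (0 * Lam 0 q)%C by ring.
    eapply is_cseries_ext; [|exact (is_cseries_scal 0 _ _ (is_cseries_Lam 0 q Hq))].
    intros n. simpl. ring.
  - eapply is_cseries_ext;
      [|exact (is_cseries_plus _ _ _ _ (is_cseries_scal (RtoC c) _ _ (is_cseries_Lam k q Hq)) IH)].
    intros n. simpl poly1. cbv beta. rewrite RtoC_plus, !RtoC_mult. ring.
Qed.

(** Leaves only polynomial identities to verify: [pH], [pG] and [ph] list the monomials of H, of
    H(x,y) - H(x-y,y) and of the sum of H(a,n-a) over 0 < a < n. *)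
Lemma lambert_identity (H : R -> R -> R) (pH pG : list (R * nat * nat)) (ph : list (R * nat))
    (e : R) (k : nat) (q : C) :
  Cmod q < 1 -> (forall x y, H x y = H y x) ->
  (forall x y, H x y - H (x - y) y = H y x - H (y - x) x) ->
  (forall x y, poly2 pH x y = H x y) ->
  (forall x y, poly2 pG x y = H x y - H (x - y) y) ->
  (forall n, poly1 ph (INR n) = sum_f_R0 (fun a => H (INR a) (INR n - INR a)) n - 2 * H 0 (INR n)) ->
  (forall x, H 0 x = e * x ^ k) ->
  lambert2 pG q = (lambert1 ph q - e * Lam2 k q)%C.
Proof.
  intros Hq Hs Hg EH EG Eh E0.
  apply (lambert_convolution q H (lambert2 pH q)); auto.
  - eapply double_lim_ext; [|apply (double_lim_poly2 q pH Hq)]. intros a b; cbv beta. now rewrite EH.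
  - eapply double_lim_ext; [|apply (double_lim_poly2 q pG Hq)]. intros a b; cbv beta. now rewrite EG.
  - eapply is_cseries_ext; [|exact (is_cseries_minus _ _ _ _ (is_cseries_poly1 q ph Hq)
      (is_cseries_scal (RtoC e) _ _ (is_cseries_Lam2 k q Hq)))].
    intros n. cbv beta. rewrite Eh, E0, (RtoC_mult e). ring.
Qed.

(** * Faulhaber's power sums and four identities between Lambert series *)

Definition power_sum1 x := x * (x + 1) / 2.
Definition power_sum2 x := x * (x + 1) * (2 * x + 1) / 6.
Definition power_sum3 x := x ^ 2 * (x + 1) ^ 2 / 4.
Definition power_sum4 x := x * (x + 1) * (2 * x + 1) * (3 * x ^ 2 + 3 * x - 1) / 30.
Definition power_sum5 x := x ^ 2 * (x + 1) ^ 2 * (2 * x ^ 2 + 2 * x - 1) / 12.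
Definition power_sum6 x := x * (x + 1) * (2 * x + 1) * (3 * x ^ 4 + 6 * x ^ 3 - 3 * x + 1) / 42.

Lemma sum_poly6 (c0 c1 c2 c3 c4 c5 c6 : R) (f : R -> R) (n : nat) :
  (forall u, f u = c0 + c1 * u + c2 * u ^ 2 + c3 * u ^ 3 + c4 * u ^ 4 + c5 * u ^ 5 + c6 * u ^ 6) ->
  sum_f_R0 (fun a => f (INR a)) n
  = c0 * (INR n + 1) + c1 * power_sum1 (INR n) + c2 * power_sum2 (INR n) + c3 * power_sum3 (INR n)
    + c4 * power_sum4 (INR n) + c5 * power_sum5 (INR n) + c6 * power_sum6 (INR n).
Proof.
  intros Hf. unfold power_sum1, power_sum2, power_sum3, power_sum4, power_sum5, power_sum6.
  induction n as [|n IH].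
  - simpl. rewrite Hf. field.
  - rewrite tech5, IH, Hf, S_INR. field.
Qed.

(** For H = x^2 + xy + y^2 the form H(x-y,y) = x^2 - xy + y^2 is again symmetric, and the difference
    is 2xy. The square and the cube of H inherit the symmetry and serve for [Lam_1_3] and
    [Lam_1_5]. *)
Lemma Lam_1_1 (q : C) : Cmod q < 1 ->
  (2 * (Lam 1 q * Lam 1 q) = 5 / 6 * Lam 3 q + / 6 * Lam 1 q - Lam 2 q - Lam2 2 q)%C.
Proof.
  intros Hq.
  pose proof (lambert_identity (fun x y => x * x + x * y + y * y)
    ((1, 2%nat, O) :: (1, 1%nat, 1%nat) :: (1, O, 2%nat) :: nil) ((2, 1%nat, 1%nat) :: nil)
    ((5 / 6, 3%nat) :: (/ 6, 1%nat) :: (-1, 2%nat) :: nil) 1 2 q Hq) as K.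
  cbn [lambert2 lambert1] in K.
  transitivity (2 * (Lam 1 q * Lam 1 q) + 0)%C; [ring|]. rewrite K.
  - rewrite RtoC_div, RtoC_inv by lra. ring.
  - intros; ring.
  - intros; ring.
  - intros; simpl; ring.
  - intros; simpl; ring.
  - intros n. cbn [poly1].
    (* The coefficients are those of H(u, n-u) = n^2 - n u + u^2 in powers of u. *)
    rewrite (sum_poly6 (INR n ^ 2) (- INR n) 1 0 0 0 0 (fun u => u * u + u * (INR n - u) + (INR n - u) * (INR n - u)))
      by (intros; ring).
    unfold power_sum1, power_sum2, power_sum3, power_sum4, power_sum5, power_sum6. field.
  - intros; simpl; ring.
Qed.

Lemma Lam_1_3 (q : C) : Cmod q < 1 ->
  (8 * (Lam 1 q * Lam 3 q) = 7 / 10 * Lam 5 q + / 3 * Lam 3 q - / 30 * Lam 1 q - Lam 4 q - Lam2 4 q)%C.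
Proof.
  intros Hq.
  pose proof (lambert_identity (fun x y => (x * x + x * y + y * y) ^ 2)
    ((1, 4%nat, O) :: (2, 3%nat, 1%nat) :: (3, 2%nat, 2%nat) :: (2, 1%nat, 3%nat) :: (1, O, 4%nat) :: nil)
    ((4, 1%nat, 3%nat) :: (4, 3%nat, 1%nat) :: nil)
    ((7 / 10, 5%nat) :: (/ 3, 3%nat) :: (- / 30, 1%nat) :: (-1, 4%nat) :: nil) 1 4 q Hq) as K.
  cbn [lambert2 lambert1] in K.
  transitivity (4 * (Lam 1 q * Lam 3 q) + (4 * (Lam 3 q * Lam 1 q) + 0))%C; [ring|]. rewrite K.
  - rewrite RtoC_div, (RtoC_opp (/ 30)), !RtoC_inv by lra. ring.
  - intros; ring.
  - intros; ring.
  - intros; simpl; ring.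
  - intros; simpl; ring.
  - intros n. cbn [poly1].
    rewrite (sum_poly6 (INR n ^ 4) (- (2) * INR n ^ 3) (3 * INR n ^ 2) (- (2) * INR n) 1 0 0
      (fun u => (u * u + u * (INR n - u) + (INR n - u) * (INR n - u)) ^ 2)) by (intros; ring).
    unfold power_sum1, power_sum2, power_sum3, power_sum4, power_sum5, power_sum6. field.
  - intros; simpl; ring.
Qed.

(** The weight (xy(x+y))^2 vanishes on the axes, hence no [Lam2] occurs. This is the identity E_4^2
    = E_8. *)
Lemma Lam_3_3 (q : C) : Cmod q < 1 ->
  (4 * (Lam 3 q * Lam 3 q) = / 30 * Lam 7 q - / 30 * Lam 3 q)%C.
Proof.
  intros Hq.
  pose proof (lambert_identity (fun x y => (x * y * (x + y)) ^ 2)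
    ((1, 4%nat, 2%nat) :: (2, 3%nat, 3%nat) :: (1, 2%nat, 4%nat) :: nil)
    ((4, 3%nat, 3%nat) :: nil)
    ((/ 30, 7%nat) :: (- / 30, 3%nat) :: nil) 0 0 q Hq) as K.
  cbn [lambert2 lambert1] in K.
  transitivity (4 * (Lam 3 q * Lam 3 q) + 0)%C; [ring|]. rewrite K.
  - rewrite (RtoC_opp (/ 30)), !RtoC_inv by lra. ring.
  - intros; ring.
  - intros; ring.
  - intros; simpl; ring.
  - intros; simpl; ring.
  - intros n. cbn [poly1].
    rewrite (sum_poly6 0 0 (INR n ^ 4) (- (2) * INR n ^ 3) (INR n ^ 2) 0 0
      (fun u => (u * (INR n - u) * (u + (INR n - u))) ^ 2)) by (intros; ring).
    unfold power_sum1, power_sum2, power_sum3, power_sum4, power_sum5, power_sum6. field.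
  - intros; simpl; ring.
Qed.

Lemma Lam_1_5 (q : C) : Cmod q < 1 ->
  (12 * (Lam 1 q * Lam 5 q) + 14 * (Lam 3 q * Lam 3 q)
   = 83 / 140 * Lam 7 q + / 2 * Lam 5 q - 7 / 60 * Lam 3 q + / 42 * Lam 1 q - Lam 6 q - Lam2 6 q)%C.
Proof.
  intros Hq.
  pose proof (lambert_identity (fun x y => (x * x + x * y + y * y) ^ 3)
    ((1, 6%nat, O) :: (3, 5%nat, 1%nat) :: (6, 4%nat, 2%nat) :: (7, 3%nat, 3%nat)
      :: (6, 2%nat, 4%nat) :: (3, 1%nat, 5%nat) :: (1, O, 6%nat) :: nil)
    ((6, 1%nat, 5%nat) :: (6, 5%nat, 1%nat) :: (14, 3%nat, 3%nat) :: nil)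
    ((83 / 140, 7%nat) :: (/ 2, 5%nat) :: (- (7 / 60), 3%nat) :: (/ 42, 1%nat) :: (-1, 6%nat) :: nil)
    1 6 q Hq) as K.
  cbn [lambert2 lambert1] in K.
  transitivity (6 * (Lam 1 q * Lam 5 q) + (6 * (Lam 5 q * Lam 1 q) + (14 * (Lam 3 q * Lam 3 q) + 0)))%C; [ring|].
  rewrite K.
  - rewrite (RtoC_opp (7 / 60)), !RtoC_div, !RtoC_inv by lra. ring.
  - intros; ring.
  - intros; ring.
  - intros; simpl; ring.
  - intros; simpl; ring.
  - intros n. cbn [poly1].
    rewrite (sum_poly6 (INR n ^ 6) (- (3) * INR n ^ 5) (6 * INR n ^ 4) (- (7) * INR n ^ 3) (6 * INR n ^ 2)
      (- (3) * INR n) 1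
      (fun u => (u * u + u * (INR n - u) + (INR n - u) * (INR n - u)) ^ 3)) by (intros; ring).
    unfold power_sum1, power_sum2, power_sum3, power_sum4, power_sum5, power_sum6. field.
  - intros; simpl; ring.
Qed.

(** * Ramanujan's differential equations for the Eisenstein series *)

Definition eisP (q : C) : C := (1 - 24 * Lam 1 q)%C.
Definition eisQ (q : C) : C := (1 + 240 * Lam 3 q)%C.
Definition eisR (q : C) : C := (1 - 504 * Lam 5 q)%C.

(** D produces [Lam 2 + Lam2 2], which [Lam_1_1] rewrites through [Lam 1], its square and [Lam 3].
    The equations for Q and R follow the same pattern. *)
Lemma qder_eisP (q : C) : Cmod q < 1 ->
  qder eisP q ((eisP q * eisP q - eisQ q) / 12)%C.
Proof.
  intros Hq. eapply qder_eq.
  - apply (qder_minus (fun _ => 1)); [apply qder_const|].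
    apply (qder_mult (fun _ => 24)); [apply qder_const | apply (qder_Lam 1 q Hq)].
  - unfold eisP, eisQ. pose proof (Lam_1_1 q Hq) as E.
    transitivity ((- (48) * Lam 1 q + 288 * (2 * (Lam 1 q * Lam 1 q)) - 240 * Lam 3 q) / 12)%C.
    + rewrite E. field.
    + field.
Qed.

Lemma qder_eisQ (q : C) : Cmod q < 1 ->
  qder eisQ q ((eisP q * eisQ q - eisR q) / 3)%C.
Proof.
  intros Hq. eapply qder_eq.
  - apply (qder_plus (fun _ => 1)); [apply qder_const|].
    apply (qder_mult (fun _ => 240)); [apply qder_const | apply (qder_Lam 3 q Hq)].
  - unfold eisP, eisQ, eisR. pose proof (Lam_1_3 q Hq) as E.
    transitivity ((- (24) * Lam 1 q + 240 * Lam 3 q + 504 * Lam 5 q - 720 * (8 * (Lam 1 q * Lam 3 q))) / 3)%C.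
    + rewrite E. field.
    + field.
Qed.

Lemma qder_eisR (q : C) : Cmod q < 1 ->
  qder eisR q ((eisP q * eisR q - eisQ q * eisQ q) / 2)%C.
Proof.
  intros Hq. eapply qder_eq.
  - apply (qder_minus (fun _ => 1)); [apply qder_const|].
    apply (qder_mult (fun _ => 504)); [apply qder_const | apply (qder_Lam 5 q Hq)].
  - unfold eisP, eisQ, eisR. pose proof (Lam_1_5 q Hq) as E. pose proof (Lam_3_3 q Hq) as F.
    transitivity ((- (24) * Lam 1 q - 504 * Lam 5 q - 480 * Lam 3 q
      + 1008 * (12 * (Lam 1 q * Lam 5 q) + 14 * (Lam 3 q * Lam 3 q))
      - 17928 * (4 * (Lam 3 q * Lam 3 q))) / 2)%C.
    + rewrite E, F. field.
    + field.
Qed.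

(** * The hypergeometric series *)

(** Equal to (1/6)_n (1/2)_n (5/6)_n / n!^3, the coefficients of 3F2(1/6, 1/2, 5/6; 1, 1; y). *)
Definition hyp_coef (n : nat) : R :=
  INR (fact (6 * n)) / (INR (fact (3 * n)) * INR (fact n) ^ 3) / 1728 ^ n.

Lemma hyp_coef_0 : hyp_coef 0 = 1.
Proof. unfold hyp_coef. simpl. field. Qed.

(** The cubic on the right is (n + 1/6)(n + 1/2)(n + 5/6). *)
Lemma hyp_coef_S (n : nat) :
  (INR n + 1) ^ 3 * hyp_coef (S n)
  = (INR n ^ 3 + 3 / 2 * INR n ^ 2 + 23 / 36 * INR n + 5 / 72) * hyp_coef n.
Proof.
  unfold hyp_coef.
  replace (6 * S n)%nat with (S (S (S (S (S (S (6 * n))))))) by lia.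
  replace (3 * S n)%nat with (S (S (S (3 * n)))) by lia.
  rewrite !fact_simpl, !mult_INR, !S_INR, !mult_INR.
  replace (INR 6) with 6 by (simpl; ring). replace (INR 3) with 3 by (simpl; ring).
  pose proof (pos_INR n). pose proof (INR_fact_neq_0 (3 * n)). pose proof (INR_fact_neq_0 n).
  pose proof (pow_nonzero 1728 n ltac:(lra)).
  change (1728 ^ S n) with (1728 * 1728 ^ n). field. repeat split; lra.
Qed.

(** Coefficient by coefficient, the cubic of the recurrence is at most (n + 1)^3. *)
Lemma hyp_coef_bounds (n : nat) : 0 <= hyp_coef n <= 1.
Proof.
  induction n as [|n [IH0 IH1]].
  - rewrite hyp_coef_0. lra.
  - pose proof (hyp_coef_S n) as E. pose proof (pos_INR n) as P.
    assert (P3 : 0 < (INR n + 1) ^ 3) by (apply pow_lt; lra).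
    set (c := INR n ^ 3 + 3 / 2 * INR n ^ 2 + 23 / 36 * INR n + 5 / 72) in *.
    assert (Hc : 0 <= c <= (INR n + 1) ^ 3).
    { unfold c. pose proof (pow_le (INR n) 2 P). pose proof (pow_le (INR n) 3 P). split; [lra|].
      simpl in *. lra. }
    split.
    + apply Rmult_le_reg_l with ((INR n + 1) ^ 3); auto. rewrite E, Rmult_0_r.
      apply Rmult_le_pos; lra.
    + apply Rmult_le_reg_l with ((INR n + 1) ^ 3); auto. rewrite E, Rmult_1_r.
      apply Rle_trans with (c * 1); [apply Rmult_le_compat_l; lra | lra].
Qed.

Definition hyp_term (k : nat) (y : C) (n : nat) : C := (RtoC (INR n ^ k * hyp_coef n) * y ^ n)%C.

Definition hyp (k : nat) (y : C) : C := csum (hyp_term k y).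

Lemma Cmod_hyp_weight_le (k n : nat) (z : C) :
  Cmod (RtoC (INR n ^ k * hyp_coef n) * z) <= INR n ^ k * Cmod z.
Proof.
  pose proof (hyp_coef_bounds n) as [H0 H1]. pose proof (pow_le _ k (pos_INR n)) as P.
  rewrite Cmod_mult, Cmod_R, Rabs_pos_eq by (now apply Rmult_le_pos).
  apply Rmult_le_compat_r; [apply Cmod_ge_0|].
  apply Rle_trans with (INR n ^ k * 1); [now apply Rmult_le_compat_l | lra].
Qed.

Lemma Cmod_hyp_term_le (k n : nat) (y : C) (rho : R) :
  Cmod y <= rho -> Cmod (hyp_term k y n) <= 1 * (INR n ^ k * rho ^ n).
Proof.
  intros H. eapply Rle_trans; [apply Cmod_hyp_weight_le|]. rewrite Rmult_1_l.
  apply Rmult_le_compat_l; [apply pow_le, pos_INR|]. rewrite Cmod_pow.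
  apply pow_incr. pose proof (Cmod_ge_0 y); lra.
Qed.

Lemma is_cseries_hyp (k : nat) (y : C) : Cmod y < 1 -> is_cseries (hyp_term k y) (hyp k y).
Proof.
  intros H. destruct (exists_radius_between y H) as [rho [Hr Hr0]].
  apply (is_cseries_dominated _ (fun n => 1 * (INR n ^ k * rho ^ n))).
  - intros n. apply Cmod_hyp_term_le. lra.
  - apply ex_series_pow_geom; lra.
Qed.

(** Termwise y d/dy multiplies by n; so [hyp k] is the k-th iterate of this operator on the
    hypergeometric function. *)
Lemma qder_hyp (k : nat) (y : C) : Cmod y < 1 -> qder (hyp k) y (hyp (S k) y).
Proof.
  intros H. destruct (exists_radius_between y H) as [rho [Hr Hr0]].
  set (g := fun n => (RtoC (INR n ^ k * hyp_coef n) * (INR n * y ^ pred n))%C).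
  assert (G : is_cseries g (csum g)).
  { apply (is_cseries_dominated _ (fun n => / rho * (INR n ^ S k * rho ^ n))).
    - intros n. unfold g. eapply Rle_trans; [apply Cmod_hyp_weight_le|].
      rewrite Cmod_mult, Cmod_R, Rabs_pos_eq by apply pos_INR.
      rewrite Cmod_pow. destruct n as [|n].
      + simpl INR. rewrite (pow_ne_zero (S k)) by lia. lra.
      + simpl pred. change (rho ^ S n) with (rho * rho ^ n). change (INR (S n) ^ S k) with (INR (S n) * INR (S n) ^ k).
        replace (/ rho * (INR (S n) * INR (S n) ^ k * (rho * rho ^ n)))
          with (INR (S n) ^ k * (INR (S n) * rho ^ n)) by (field; lra).
        apply Rmult_le_compat_l; [apply pow_le, pos_INR|].
        apply Rmult_le_compat_l; [apply pos_INR|]. apply pow_incr.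
        pose proof (Cmod_ge_0 y); lra.
    - apply ex_series_pow_geom; [|lra]. left. now apply Rinv_0_lt_compat. }
  exists (csum g). split.
  - apply (cder_cseries (fun n z => hyp_term k z n) (hyp k) g _ y (rho - Cmod y)
      (fun n => / rho ^ 2 * (INR n ^ (k + 2) * rho ^ n))); [lra| | |exact G|].
    + apply ex_series_pow_geom; [|lra]. left. apply Rinv_0_lt_compat. apply pow_lt; lra.
    + intros h Hh. apply is_cseries_hyp. pose proof (Cmod_triangle y h). lra.
    + intros n h Hh. pose proof (Cmod_triangle y h).
      unfold hyp_term, g.
      replace (RtoC (INR n ^ k * hyp_coef n) * (y + h) ^ n - RtoC (INR n ^ k * hyp_coef n) * y ^ n
         - h * (RtoC (INR n ^ k * hyp_coef n) * (INR n * y ^ pred n)))%C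
        with (RtoC (INR n ^ k * hyp_coef n) * ((y + h) ^ n - y ^ n - h * (INR n * y ^ pred n)))%C by ring.
      eapply Rle_trans; [apply Cmod_hyp_weight_le|].
      assert (P2 : 0 < rho ^ 2) by (apply pow_lt; lra).
      apply Rle_trans with (INR n ^ k * (INR n ^ 2 * rho ^ n * Cmod h ^ 2 / rho ^ 2)).
      * apply Rmult_le_compat_l; [apply pow_le, pos_INR|].
        apply (proj1 (Rle_div_r _ _ _ P2)). apply Cpow_taylor1_le; lra.
      * right. rewrite pow_add. field. lra.
  - rewrite <- (is_cseries_unique _ _ (is_cseries_scal y _ _ G)). apply is_cseries_unique.
    eapply is_cseries_ext; [|apply is_cseries_hyp; exact H].
    intros n. unfold hyp_term, g. destruct n as [|n].
    + simpl. rewrite !Rmult_0_l. ring.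
    + simpl pred. change (INR (S n) ^ S k) with (INR (S n) * INR (S n) ^ k).
      rewrite !RtoC_mult. simpl Cpow. ring.
Qed.

(** The recurrence [hyp_coef_S] times y^(n+1), summed over n; [hyp 3] has no constant term, so the
    shift of the index loses nothing. *)
Lemma hyp_ode (y : C) : Cmod y < 1 ->
  ((1 - y) * hyp 3 y = y * (3 / 2 * hyp 2 y + 23 / 36 * hyp 1 y + 5 / 72 * hyp 0 y))%C.
Proof.
  intros H.
  assert (E : hyp 3 y = (y * (hyp 3 y + (RtoC (3 / 2) * hyp 2 y + (RtoC (23 / 36) * hyp 1 y + RtoC (5 / 72) * hyp 0 y))))%C).
  { rewrite <- (is_cseries_unique _ _ (is_cseries_hyp 3 y H)) at 1.
    apply is_cseries_unique. apply is_cseries_decr_1.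
    { unfold hyp_term. simpl. rewrite !Rmult_0_l. ring. }
    eapply is_cseries_ext; [|apply is_cseries_scal;
      repeat first [apply is_cseries_plus | apply is_cseries_scal | apply is_cseries_hyp; exact H]].
    intros n. cbv beta. unfold hyp_term. rewrite S_INR, hyp_coef_S.
    repeat rewrite ?RtoC_mult, ?RtoC_plus, ?RtoC_pow. simpl Cpow. ring. }
  rewrite !RtoC_div in E by lra.
  transitivity (hyp 3 y - y * hyp 3 y)%C; [ring|]. rewrite E at 1. ring.
Qed.

Lemma hyp_0_0 : hyp 0 0 = 1.
Proof.
  apply is_cseries_unique, is_cseries_clim.
  apply clim_ext with (fun _ => RtoC 1); [|apply clim_const].
  induction n as [|n IH]; simpl csumn.
  - unfold hyp_term. rewrite hyp_coef_0. simpl. rewrite Rmult_1_l. ring.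
  - rewrite <- IH. unfold hyp_term. simpl Cpow. ring.
Qed.

Lemma hyp_S_0 (k : nat) : hyp (S k) 0 = 0.
Proof.
  assert (H : Cmod 0 < 1) by (rewrite Cmod_0; lra).
  transitivity (0 * hyp (S k) 0)%C; [|ring]. apply is_cseries_unique.
  eapply is_cseries_ext; [|apply is_cseries_scal, is_cseries_hyp; exact H].
  intros n. unfold hyp_term. destruct n as [|n]; simpl; [rewrite !Rmult_0_l|]; ring.
Qed.

(** * Estimates on the disc of radius 1/2500 *)

Lemma is_cseries_delta1 (q : C) : is_cseries (fun n => if Nat.eqb n 1 then q else 0)%C q.
Proof.
  apply is_cseries_decr_1; [reflexivity|]. apply is_cseries_clim.
  apply clim_ext with (fun _ => q); [|apply clim_const].
  induction n as [|n IH]; [reflexivity|]. simpl csumn in *. rewrite <- IH. simpl. ring.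
Qed.

Lemma is_series_decr_1_R (a : nat -> R) (l : R) :
  is_series (fun n => a (S n)) l -> is_series a (a O + l).
Proof.
  intros H. apply is_series_decr_1. change (plus (a O + l) (opp (a O))) with (a O + l + - a O).
  now replace (a O + l + - a O) with l by ring.
Qed.

(** The term n = 1 differs from q by q L_1. From n = 2 on, n^k grows at most by the factor [d] per
    step, so the tail is dominated by a geometric series of ratio d |q|. *)
Lemma Cmod_Lam_minus_q_le (k : nat) (d : R) (q : C) :
  0 < d -> Cmod q < 1 -> d * Cmod q < 1 ->
  (forall x, 2 <= x -> (x + 1) ^ k <= d * x ^ k) ->
  Cmod (Lam k q - q)%C
    <= Cmod q ^ 2 / (1 - Cmod q) * (1 + 2 ^ k / (1 - d * Cmod q)).
Proof.
  intros Hd Hq Hdq Hk. set (t := Cmod q) in *. pose proof (Cmod_ge_0 q) as Pt. fold t in Pt.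
  assert (Hw : forall n, INR (S (S n)) ^ k <= 2 ^ k * d ^ n).
  { induction n as [|n IH]; [simpl INR; simpl pow; replace (1 + 1) with 2 by ring; lra|].
    rewrite (S_INR (S (S n))). eapply Rle_trans; [apply Hk|].
    - rewrite !S_INR. pose proof (pos_INR n). lra.
    - simpl (d ^ S n). nra. }
  set (M := fun n => match n with
    | O => 0 | S O => t ^ 2 / (1 - t)
    | S (S m) => 2 ^ k * t ^ 2 / (1 - t) * (d * t) ^ m end).
  assert (HM : is_series M (M O + (M 1%nat + 2 ^ k * t ^ 2 / (1 - t) * / (1 - d * t)))).
  { apply is_series_decr_1_R. apply (is_series_decr_1_R (fun n => M (S n))).
    apply (is_series_scal (2 ^ k * t ^ 2 / (1 - t)) (fun n => (d * t) ^ n)).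
    apply is_series_geom. rewrite Rabs_pos_eq; nra. }
  replace (t ^ 2 / (1 - t) * (1 + 2 ^ k / (1 - d * t)))
    with (M O + (M 1%nat + 2 ^ k * t ^ 2 / (1 - t) * / (1 - d * t))) by (simpl; field; lra).
  eapply Cmod_cseries_le; [|exact HM|
    exact (is_cseries_minus _ _ _ _ (is_cseries_Lam k q Hq) (is_cseries_delta1 q))].
  assert (L : forall n, Cmod (lamb q n) <= t ^ n / (1 - t)) by (intros n; apply Cmod_lamb_le; split; [apply Rle_refl | exact Hq]).
  intros [|[|n]]; cbv beta.
  - rewrite lamb_0. simpl Nat.eqb. cbv iota.
    replace (RtoC (INR 0 ^ k) * 0 - 0)%C with (RtoC 0) by ring. rewrite Cmod_0. simpl; lra.
  - simpl Nat.eqb. cbv iota. simpl INR. rewrite pow1.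
    assert (E : (1 * lamb q 1 - q = q * lamb q 1)%C).
    { unfold lamb. pose proof (one_minus_pow_neq_0 q 1 ltac:(lia) Hq) as N. rewrite Cpow_1_r in *. field. exact N. }
    rewrite E, Cmod_mult. fold t. simpl M. specialize (L 1%nat). rewrite pow_1 in L.
    replace (t * (t * 1) / (1 - t)) with (t * (t / (1 - t))) by (field; lra).
    now apply Rmult_le_compat_l.
  - simpl Nat.eqb. cbv iota.
    replace (RtoC (INR (S (S n)) ^ k) * lamb q (S (S n)) - 0)%C with (RtoC (INR (S (S n)) ^ k) * lamb q (S (S n)))%C by ring.
    rewrite Cmod_mult, Cmod_R, Rabs_pos_eq by (apply pow_le, pos_INR).
    simpl M. apply Rle_trans with (2 ^ k * d ^ n * (t ^ S (S n) / (1 - t))).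
    + apply Rmult_le_compat; auto using Cmod_ge_0. apply pow_le, pos_INR.
    + right. rewrite Rpow_mult_distr. simpl. field. lra.
Qed.

Lemma Lam3_near (q : C) : Cmod q < / 2500 -> Cmod (Lam 3 q - q)%C <= 10 * Cmod q ^ 2.
Proof.
  intros H. pose proof (Cmod_ge_0 q) as P.
  (* The growth factor 4 is admissible because (3/2)^3 < 4; for the fifth power it is 8, because
     (3/2)^5 < 8. *)
  eapply Rle_trans; [apply (Cmod_Lam_minus_q_le 3 4 q)|]; try lra.
  - intros x Hx. nra.
  - set (t := Cmod q) in *.
    assert (/ (1 - t) <= 1.001) by (rewrite <- (Rinv_inv 1.001); apply Rinv_le_contravar; lra).
    assert (/ (1 - 4 * t) <= 1.01) by (rewrite <- (Rinv_inv 1.01); apply Rinv_le_contravar; lra).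
    assert (0 < / (1 - t)) by (apply Rinv_0_lt_compat; lra).
    unfold Rdiv. rewrite Rmult_assoc, (Rmult_comm 10). apply Rmult_le_compat_l; [apply pow2_ge_0|].
    nra.
Qed.

Lemma Lam5_near (q : C) : Cmod q < / 2500 -> Cmod (Lam 5 q - q)%C <= 40 * Cmod q ^ 2.
Proof.
  intros H. pose proof (Cmod_ge_0 q) as P.
  eapply Rle_trans; [apply (Cmod_Lam_minus_q_le 5 8 q)|]; try lra.
  - intros x Hx. replace x with ((x - 2) + 2) by ring. set (u := x - 2) in *.
    assert (0 <= u) by (unfold u; lra). simpl.
    assert (0 <= u ^ 2) by apply pow2_ge_0. assert (0 <= u ^ 3) by (now apply pow_le).
    assert (0 <= u ^ 4) by (now apply pow_le). assert (0 <= u ^ 5) by (now apply pow_le).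
    ring_simplify. lra.
  - set (t := Cmod q) in *.
    assert (/ (1 - t) <= 1.001) by (rewrite <- (Rinv_inv 1.001); apply Rinv_le_contravar; lra).
    assert (/ (1 - 8 * t) <= 1.01) by (rewrite <- (Rinv_inv 1.01); apply Rinv_le_contravar; lra).
    assert (0 < / (1 - t)) by (apply Rinv_0_lt_compat; lra).
    unfold Rdiv. rewrite Rmult_assoc, (Rmult_comm 40). apply Rmult_le_compat_l; [apply pow2_ge_0|].
    nra.
Qed.

Lemma Cmod_reverse_triangle (a b : C) : Cmod a - Cmod b <= Cmod (a + b)%C.
Proof.
  pose proof (Cmod_triangle (a + b) (- b)) as T.
  replace (a + b + - b)%C with a in T by ring. rewrite Cmod_opp in T. lra.
Qed.

Lemma Cmod_le_of_minus (z q : C) (e : R) : Cmod (z - q)%C <= e -> Cmod z <= Cmod q + e.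
Proof.
  intros H. pose proof (Cmod_triangle (z - q) q) as T.
  replace (z - q + q)%C with z in T by ring. lra.
Qed.

(** |Q| is at least 1 - 240 (t + 10 t^2) with t = |q|, which exceeds 0.9036 at t = 1/2500. *)
Lemma Cmod_eisQ_ge (q : C) : Cmod q < / 2500 -> 0.9035 <= Cmod (eisQ q).
Proof.
  intros H. pose proof (Cmod_ge_0 q) as P. pose proof (Cmod_le_of_minus _ _ _ (Lam3_near q H)) as L.
  unfold eisQ. pose proof (Cmod_reverse_triangle 1 (240 * Lam 3 q)) as T.
  rewrite Cmod_1, Cmod_mult, Cmod_R, Rabs_pos_eq in T by lra. nra.
Qed.

Lemma eisQ_neq_0 (q : C) : Cmod q < / 2500 -> eisQ q <> 0.
Proof. intros H. apply Cmod_gt_0. pose proof (Cmod_eisQ_ge q H). lra. Qed.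

Lemma eisR_neq_0 (q : C) : Cmod q < / 2500 -> eisR q <> 0.
Proof.
  intros H. apply Cmod_gt_0. pose proof (Cmod_ge_0 q) as P.
  pose proof (Cmod_le_of_minus _ _ _ (Lam5_near q H)) as L.
  unfold eisR. pose proof (Cmod_reverse_triangle 1 (- (504 * Lam 5 q))) as T.
  rewrite Cmod_1, Cmod_opp, Cmod_mult, Cmod_R, Rabs_pos_eq in T by lra. unfold Cminus. nra.
Qed.

Lemma Cmod_scal_le (c : R) (z : C) (b : R) : Cmod z <= b -> Cmod (c * z)%C <= Rabs c * b.
Proof.
  intros H. rewrite Cmod_mult, Cmod_R. apply Rmult_le_compat_l; [apply Rabs_pos | exact H].
Qed.

Lemma Cmod_plus_le (z w : C) (a b : R) : Cmod z <= a -> Cmod w <= b -> Cmod (z + w)%C <= a + b.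
Proof. intros Hz Hw. pose proof (Cmod_triangle z w). lra. Qed.

Lemma Cmod_mult_le (z w : C) (a b : R) : Cmod z <= a -> Cmod w <= b -> Cmod (z * w)%C <= a * b.
Proof.
  intros Hz Hw. rewrite Cmod_mult. apply Rmult_le_compat; auto using Cmod_ge_0.
Qed.

Lemma discriminant_near (q : C) : Cmod q < / 2500 ->
  Cmod (eisQ q ^ 3 - eisR q ^ 2 - 1728 * q)%C <= 145000 * Cmod q ^ 2.
Proof.
  intros H. pose proof (Cmod_ge_0 q) as P.
  pose proof (Lam3_near q H) as L3. pose proof (Lam5_near q H) as L5.
  set (a := (Lam 3 q - q)%C) in *. set (b := (Lam 5 q - q)%C) in *.
  assert (E3 : Lam 3 q = (q + a)%C) by (unfold a; ring).
  assert (E5 : Lam 5 q = (q + b)%C) by (unfold b; ring).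
  pose proof (Rle_refl (Cmod q)) as Lq.
  unfold eisQ, eisR. rewrite E3, E5. clearbody a b. clear E3 E5.
  (* The linear terms 720 q + 1008 q cancel against 1728 q. As [a] and [b] are of order |q|^2, every
     remaining monomial is at least quadratic. *)
  replace ((1 + 240 * (q + a)) ^ 3 - (1 - 504 * (q + b)) ^ 2 - 1728 * q)%C
    with (RtoC 720 * a + (RtoC 1008 * b + (RtoC (-81216) * (q * q) + (RtoC 345600 * (q * a) + (RtoC 172800 * (a * a)
          + (RtoC (-508032) * (q * b) + (RtoC (-254016) * (b * b) + RtoC 13824000 * ((q + a) * ((q + a) * (q + a))))))))))%C
    by ring.
  eapply Rle_trans.
  { repeat first [ apply Cmod_plus_le | apply Cmod_scal_le | apply Cmod_mult_le
                 | exact L3 | exact L5 | exact Lq ]. }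
  rewrite (Rabs_left (-81216)), (Rabs_left (-508032)), (Rabs_left (-254016)) by lra. rewrite !Rabs_pos_eq by lra.
  set (t := Cmod q) in *.
  assert (T3 : t ^ 3 <= / 2500 * t ^ 2) by (simpl; assert (0 <= t * (t * 1)) by nra; nra).
  assert (T4 : t ^ 4 <= / 2500 * t ^ 3) by (assert (0 <= t ^ 3) by (now apply pow_le); simpl in *; nra).
  assert (T5 : t ^ 5 <= / 2500 * t ^ 4) by (assert (0 <= t ^ 4) by (now apply pow_le); simpl in *; nra).
  assert (T6 : t ^ 6 <= / 2500 * t ^ 5) by (assert (0 <= t ^ 5) by (now apply pow_le); simpl in *; nra).
  pose proof (pow2_ge_0 t). lra.
Qed.

(** The linear term dominates, since 145000/2500 = 58 < 1728. *)
Lemma discriminant_neq_0 (q : C) : Cmod q < / 2500 -> q <> 0 -> (eisQ q ^ 3 - eisR q ^ 2)%C <> 0.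
Proof.
  intros H Hn E. pose proof (discriminant_near q H) as D. rewrite E in D.
  apply Cmod_gt_0 in Hn. replace (0 - 1728 * q)%C with (RtoC (-1728) * q)%C in D by ring.
  rewrite Cmod_mult, Cmod_R, Rabs_left in D by lra. nra.
Qed.

(** 1/J is used instead of J, which has a pole at q = 0. *)
Definition inv_J (q : C) : C := (1 - eisR q / eisQ q * (eisR q / eisQ q) / eisQ q)%C.

Lemma inv_J_eq (q : C) : Cmod q < / 2500 ->
  inv_J q = ((eisQ q ^ 3 - eisR q ^ 2) / eisQ q ^ 3)%C.
Proof. intros H. unfold inv_J. field. now apply eisQ_neq_0. Qed.

(** At |q| = 1/2500 the numerator bound 1728 |q| + 145000 |q|^2 is 0.7144, while 0.9035^3 >
    0.737. *)
Lemma Cmod_inv_J_lt_1 (q : C) : Cmod q < / 2500 -> Cmod (inv_J q) < 1.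
Proof.
  intros H. rewrite inv_J_eq by assumption. pose proof (eisQ_neq_0 q H) as N.
  rewrite Cmod_div by (now apply Cpow_nz).
  assert (N3 : 0 < Cmod (eisQ q ^ 3)) by (apply Cmod_gt_0; now apply Cpow_nz).
  apply Rlt_div_l; auto. rewrite Rmult_1_l, Cmod_pow.
  pose proof (Cmod_eisQ_ge q H) as B. pose proof (discriminant_near q H) as D.
  pose proof (Cmod_ge_0 q) as P.
  pose proof (Cmod_triangle (eisQ q ^ 3 - eisR q ^ 2 - 1728 * q) (RtoC 1728 * q)) as T.
  replace (eisQ q ^ 3 - eisR q ^ 2 - 1728 * q + RtoC 1728 * q)%C with (eisQ q ^ 3 - eisR q ^ 2)%C in T by ring.
  rewrite (Cmod_mult 1728), Cmod_R, Rabs_pos_eq in T by lra.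
  assert (0.9035 ^ 3 <= Cmod (eisQ q) ^ 3) by (apply pow_incr; lra).
  nra.
Qed.

(** * The differential equation in q *)

Definition eisS (q : C) : C := (eisR q * / eisQ q)%C.

Definition dS (q : C) : C := (eisP q * eisS q / 6 - eisQ q / 2 + eisS q * eisS q / 3)%C.

Lemma Cmod_lt_1_of_small (q : C) : Cmod q < / 2500 -> Cmod q < 1.
Proof. lra. Qed.

Lemma eisR_eq (q : C) : Cmod q < / 2500 -> eisR q = (eisS q * eisQ q)%C.
Proof. intros H. unfold eisS. field. now apply eisQ_neq_0. Qed.

Lemma qder_eisS (q : C) : Cmod q < / 2500 -> qder eisS q (dS q).
Proof.
  intros H. pose proof (eisQ_neq_0 q H) as N. pose proof (Cmod_lt_1_of_small q H) as H1.
  eapply qder_eq.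
  - apply qder_mult; [apply qder_eisR; auto|]. apply qder_inv; auto. apply qder_eisQ; auto.
  - unfold dS. rewrite (eisR_eq q H). field. auto.
Qed.

(** Half the logarithmic derivative of Q is thus (P - S)/6, the coefficient of the connection
    below. *)
Lemma qder_eisQ_S (q : C) : Cmod q < / 2500 ->
  qder eisQ q (eisQ q * ((eisP q - eisS q) / 3))%C.
Proof.
  intros H. eapply qder_eq; [apply qder_eisQ; lra|]. rewrite (eisR_eq q H). field.
Qed.

Lemma inv_J_eisS (q : C) : inv_J q = (1 - eisS q * eisS q * / eisQ q)%C.
Proof. reflexivity. Qed.

(** P drops out of D(S^2/Q), which leaves S^3/Q - S = -S y. *)
Lemma qder_inv_J (q : C) : Cmod q < / 2500 -> qder inv_J q (eisS q * inv_J q)%C.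
Proof.
  intros H. pose proof (eisQ_neq_0 q H) as N.
  eapply qder_eq.
  - apply (qder_minus (fun _ => 1) (fun q => eisS q * eisS q * / eisQ q)%C); [apply qder_const|].
    apply (qder_mult (fun q => eisS q * eisS q)%C (fun q => / eisQ q)%C).
    + apply qder_mult; apply qder_eisS; auto.
    + apply qder_inv; auto. apply qder_eisQ_S; auto.
  - rewrite inv_J_eisS. unfold dS. field. auto.
Qed.

Definition hypJ (k : nat) (q : C) : C := hyp k (inv_J q).

Lemma qder_hypJ (k : nat) (q : C) : Cmod q < / 2500 ->
  qder (hypJ k) q (eisS q * hypJ (S k) q)%C.
Proof.
  intros H. destruct (qder_hyp k (inv_J q) (Cmod_inv_J_lt_1 q H)) as [d [H1 H2]].
  eapply qder_eq; [apply (qder_comp (hyp k) inv_J); [apply qder_inv_J; auto | exact H1]|].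
  unfold hypJ. rewrite <- H2. ring.
Qed.

(** [hyp_ode] multiplied by Q, with 1 - y = S^2/Q. *)
Lemma hypJ_ode (q : C) : Cmod q < / 2500 ->
  (eisS q * eisS q * hypJ 3 q
   = (eisQ q - eisS q * eisS q) * (3 / 2 * hypJ 2 q + 23 / 36 * hypJ 1 q + 5 / 72 * hypJ 0 q))%C.
Proof.
  intros H. pose proof (eisQ_neq_0 q H) as N.
  pose proof (hyp_ode (inv_J q) (Cmod_inv_J_lt_1 q H)) as E.
  unfold hypJ. rewrite inv_J_eisS in E at 1 3. rewrite inv_J_eisS in *.
  set (y := (1 - eisS q * eisS q * / eisQ q)%C) in *.
  transitivity (eisQ q * ((1 - (1 - eisS q * eisS q * / eisQ q)) * hyp 3 y))%C; [field; auto|].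
  fold y. rewrite E. unfold y at 1. field. auto.
Qed.

(* [covA] and [covB] are the first and second covariant derivatives of [hypJ 0] for the connection
   D - (P - S)/6, whose flat sections are the multiples of the square root of [eisQ]; that the third
   one vanishes is the hypergeometric equation. *)
Definition covA (q : C) : C := (eisS q * hypJ 1 q - hypJ 0 q * ((eisP q - eisS q) * / 6))%C.

Definition dA (q : C) : C :=
  (dS q * hypJ 1 q + eisS q * (eisS q * hypJ 2 q)
   - (eisS q * hypJ 1 q * ((eisP q - eisS q) * / 6)
      + hypJ 0 q * (((eisP q * eisP q - eisQ q) * / 12 - dS q) * / 6)))%C.

Definition covB (q : C) : C := (dA q - covA q * ((eisP q - eisS q) * / 6))%C.

Ltac qd q H :=
  repeat first
   [ apply (qder_const _ q)
   | apply (qder_eisS q H) | apply (qder_eisQ_S q H) | apply (qder_hypJ _ q H)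
   | apply (qder_eisP q (Cmod_lt_1_of_small q H))
   | apply qder_minus | apply qder_plus | apply qder_mult ].

Lemma qder_covA (q : C) : Cmod q < / 2500 -> qder covA q (dA q).
Proof.
  intros H. eapply qder_eq.
  - unfold covA. qd q H.
  - unfold dA. field.
Qed.

Lemma qder_covB (q : C) : Cmod q < / 2500 ->
  qder covB q (covB q * ((eisP q - eisS q) / 6))%C.
Proof.
  intros H. pose proof (hypJ_ode q H) as E.
  eapply qder_eq.
  - unfold covB, dA, covA, dS, Cdiv. qd q H.
  - unfold covB, dA, covA, dS.
    set (s := eisS q) in *. set (Q := eisQ q) in *. set (P := eisP q) in *.
    set (w0 := hypJ 0 q) in *. set (w1 := hypJ 1 q) in *. set (w2 := hypJ 2 q) in *.
    set (w3 := hypJ 3 q) in *.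
    assert (Z : forall a b : C, (a - b)%C = 0 -> a = b).
    { intros a b K. replace a with ((a - b) + b)%C by ring. rewrite K. ring. }
    apply Z.
    (* The third covariant derivative is S times the difference of the two sides of [hypJ_ode]. *)
    transitivity (s * (s * s * w3 - (Q - s * s) * (3 / 2 * w2 + 23 / 36 * w1 + 5 / 72 * w0)))%C.
    + field.
    + rewrite E. ring.
Qed.

(** The logarithmic derivatives of f^2 and of Q are both (P - S)/3. *)
Lemma square_over_eisQ_constant (f : C -> C) :
  (forall z, Cmod z < / 2500 -> qder f z (f z * ((eisP z - eisS z) / 6))%C) ->
  forall q, Cmod q < / 2500 -> (f q * f q * / eisQ q = f 0 * f 0 * / eisQ 0)%C.
Proof.
  intros Hf z Hz.
  apply (constant_of_qder_0 (fun z => f z * f z * / eisQ z)%C (/ 2500) z); auto.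
  intros w Hw. pose proof (eisQ_neq_0 w Hw) as N. eapply qder_eq.
  - apply (qder_mult (fun z => f z * f z)%C (fun z => / eisQ z)%C).
    + apply qder_mult; apply Hf; auto.
    + apply qder_inv; auto. apply qder_eisQ_S; auto.
  - field. auto.
Qed.

Lemma eisP_0 : eisP 0 = 1.
Proof. unfold eisP. rewrite Lam_0. ring. Qed.

Lemma eisQ_0 : eisQ 0 = 1.
Proof. unfold eisQ. rewrite Lam_0. ring. Qed.

Lemma eisS_0 : eisS 0 = 1.
Proof. unfold eisS. rewrite eisQ_0. unfold eisR. rewrite Lam_0. field. Qed.

Lemma inv_J_0 : inv_J 0 = 0.
Proof. rewrite inv_J_eisS, eisS_0, eisQ_0. field. Qed.

Lemma hypJ_0_0 : hypJ 0 0 = 1.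
Proof. unfold hypJ. rewrite inv_J_0. apply hyp_0_0. Qed.

Lemma hypJ_S_0 (k : nat) : hypJ (S k) 0 = 0.
Proof. unfold hypJ. rewrite inv_J_0. apply hyp_S_0. Qed.

Lemma covA_0 : covA 0 = 0.
Proof. unfold covA. rewrite hypJ_S_0, eisP_0, eisS_0. ring. Qed.

(** At q = 0 the functions P, Q, S are 1, so [dS] is 1/6 - 1/2 + 1/3 = 0 and P^2 - Q vanishes. *)
Lemma covB_0 : covB 0 = 0.
Proof.
  unfold covB, dA, dS. rewrite covA_0, !hypJ_S_0, hypJ_0_0, eisP_0, eisS_0, eisQ_0. field.
Qed.

Lemma flat_section_vanishes (f : C -> C) :
  (forall z, Cmod z < / 2500 -> qder f z (f z * ((eisP z - eisS z) / 6))%C) ->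
  f 0 = 0 -> forall q, Cmod q < / 2500 -> f q = 0.
Proof.
  intros Hf H0 q Hq. pose proof (square_over_eisQ_constant f Hf q Hq) as E.
  rewrite H0, !Cmult_0_l in E.
  destruct (Ceq_dec (f q) 0) as [|N]; auto. exfalso. revert E.
  apply Cmult_neq_0; [now apply Cmult_neq_0|].
  pose proof (eisQ_neq_0 q Hq) as NQ. intros K. apply NQ.
  transitivity (eisQ q * (eisQ q * / eisQ q))%C; [field; auto|]. rewrite K. ring.
Qed.

Lemma covB_eq_0 (q : C) : Cmod q < / 2500 -> covB q = 0.
Proof. apply flat_section_vanishes; [apply qder_covB | apply covB_0]. Qed.

(** Once [covB] is zero, [covA] satisfies the flatness equation itself. *)
Lemma covA_eq_0 (q : C) : Cmod q < / 2500 -> covA q = 0.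
Proof.
  apply flat_section_vanishes; [|apply covA_0].
  intros z Hz. eapply qder_eq; [now apply qder_covA|].
  transitivity (covB z + covA z * ((eisP z - eisS z) / 6))%C.
  - unfold covB. field.
  - rewrite covB_eq_0 by assumption. ring.
Qed.

Lemma hypJ_1_eq (q : C) : Cmod q < / 2500 ->
  (eisS q * hypJ 1 q = hypJ 0 q * ((eisP q - eisS q) / 6))%C.
Proof.
  intros H. pose proof (covA_eq_0 q H) as E. unfold covA in E.
  transitivity (eisS q * hypJ 1 q - hypJ 0 q * ((eisP q - eisS q) * / 6)
    + hypJ 0 q * ((eisP q - eisS q) / 6))%C; [field|]. rewrite E. ring.
Qed.

(** W_0 is flat by [hypJ_1_eq], so W_0^2/Q keeps its value 1 at q = 0. *)
Lemma hypJ_0_sqr (q : C) : Cmod q < / 2500 -> (hypJ 0 q * hypJ 0 q = eisQ q)%C.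
Proof.
  intros H. pose proof (eisQ_neq_0 q H) as N.
  assert (E := square_over_eisQ_constant (hypJ 0)).
  specialize (E ltac:(intros z Hz; eapply qder_eq; [now apply qder_hypJ | now apply hypJ_1_eq]) q H).
  rewrite hypJ_0_0, eisQ_0 in E.
  transitivity (hypJ 0 q * hypJ 0 q * / eisQ q * eisQ q)%C; [field; auto|]. rewrite E. field.
Qed.

Lemma eisS_neq_0 (q : C) : Cmod q < / 2500 -> eisS q <> 0.
Proof.
  intros H E. apply (eisR_neq_0 q H). rewrite (eisR_eq q H), E. ring.
Qed.

Lemma hypJ_ratio_sqr (q : C) : Cmod q < / 2500 ->
  (hypJ 0 q * / eisS q * (hypJ 0 q * / eisS q) = / (1 - inv_J q))%C.
Proof.
  intros H. pose proof (eisQ_neq_0 q H) as N. pose proof (eisS_neq_0 q H) as NS.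
  transitivity (hypJ 0 q * hypJ 0 q * / (eisS q * eisS q))%C; [field; auto|].
  rewrite hypJ_0_sqr by assumption. rewrite inv_J_eisS.
  replace (1 - (1 - eisS q * eisS q * / eisQ q))%C with (eisS q * eisS q * / eisQ q)%C by ring.
  field. auto.
Qed.

Lemma fst_inv_1_minus_pos (y : C) : Cmod y < 1 -> 0 < fst (/ (1 - y))%C.
Proof.
  intros H. pose proof (Rabs_fst_le_Cmod y). pose proof (Rle_abs (fst y)).
  simpl. apply Rdiv_lt_0_compat; [lra|].
  assert (0 < 1 + - fst y) by lra. pose proof (pow2_ge_0 (0 + - snd y)). simpl in *. nra.
Qed.

(** The square 1/(1 - y) has positive real part, so W_0/S is never purely imaginary; at q = 0 it
    equals 1. *)
Lemma fst_hypJ_ratio_pos (q : C) : Cmod q < / 2500 -> 0 < fst (hypJ 0 q * / eisS q)%C.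
Proof.
  intros H.
  apply (fst_pos_of_nonzero (fun q => hypJ 0 q * / eisS q)%C (/ 2500)); auto.
  - intros z Hz. eexists. apply (qder_mult (hypJ 0) (fun q => / eisS q)%C); [now apply qder_hypJ|].
    apply qder_inv; [now apply eisS_neq_0 | now apply qder_eisS].
  - intros z Hz K. pose proof (hypJ_ratio_sqr z Hz) as E.
    pose proof (fst_inv_1_minus_pos _ (Cmod_inv_J_lt_1 z Hz)) as P. rewrite <- E in P.
    set (w := (hypJ 0 z * / eisS z)%C) in *.
    change (fst (w * w)%C) with (fst w * fst w - snd w * snd w) in P. rewrite K in P. nra.
  - rewrite hypJ_0_0, eisS_0. replace (1 * / 1)%C with (RtoC 1) by field. simpl. lra.
Qed.

(** * Translation to the types of the statement *)

(** Two terms of each alternating series in pi/4 = 2 arctan(1/3) + arctan(1/7). *)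
Lemma PI_ge : 3.1348 <= PI.
Proof.
  pose proof (proj1 (PI_2_3_7_ineq 0)) as H.
  unfold tg_alt, PI_2_3_7_tg, Ratan_seq in H. simpl in H. lra.
Qed.

(** |q| = exp(-5 pi/2) when Im tau = 5/4. Numerically 8 * 0.9796 < 5/2 * 3.1348 and 2.66^8 >
    2506. *)
Lemma exp_gt_2500 : 2500 < exp (5 / 2 * PI).
Proof.
  assert (E : 2.66 <= exp 0.9796).
  { eapply Rle_trans; [|apply (exp_ge_taylor 0.9796 6); lra]. simpl. lra. }
  assert (E2 : 2.66 ^ 8 <= exp 0.9796 ^ 8) by (apply pow_incr; lra).
  assert (E3 : exp 0.9796 ^ 8 <= exp (5 / 2 * PI)).
  { simpl. rewrite Rmult_1_r, <- !exp_plus. left. apply exp_increasing. pose proof PI_ge. lra. }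
  simpl in E2. lra.
Qed.

(** Carries the records of the statement to Coquelicot's pairs, where [ring] and [field] work. *)
Definition toC (z : Cpx) : C := (Defs.Re z, Defs.Im z).

Lemma toC_RtoC (x : R) : toC (Defs.RtoC x) = RtoC x.
Proof. reflexivity. Qed.

Lemma toC_C1 : toC Defs.C1 = 1.
Proof. reflexivity. Qed.

Lemma toC_add (z w : Cpx) : toC (Cadd z w) = (toC z + toC w)%C.
Proof. reflexivity. Qed.

Lemma toC_sub (z w : Cpx) : toC (Csub z w) = (toC z - toC w)%C.
Proof. reflexivity. Qed.

Lemma toC_mul (z w : Cpx) : toC (Cmul z w) = (toC z * toC w)%C.
Proof. reflexivity. Qed.

Lemma toC_inv (z : Cpx) : toC (Defs.Cinv z) = (/ toC z)%C.
Proof.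
  unfold toC, Defs.Cinv, Cinv; simpl. apply injective_projections; simpl; now rewrite !Rmult_1_r.
Qed.

Lemma toC_div (z w : Cpx) : toC (Defs.Cdiv z w) = (toC z / toC w)%C.
Proof. unfold Defs.Cdiv, Cdiv. now rewrite toC_mul, toC_inv. Qed.

Lemma toC_pow (z : Cpx) (n : nat) : toC (Defs.Cpow z n) = (toC z ^ n)%C.
Proof. induction n as [|n IH]; [reflexivity|]. simpl. now rewrite toC_mul, IH. Qed.

Lemma Cnorm_Cmod (z : Cpx) : Cnorm z = Cmod (toC z).
Proof. unfold Cnorm, Cmod; simpl. now rewrite !Rmult_1_r. Qed.

Lemma toC_partial (f : nat -> Cpx) (n : nat) : toC (Cpartial f n) = csumn (fun i => toC (f i)) n.
Proof. induction n as [|n IH]; [reflexivity|]. simpl. now rewrite toC_add, IH. Qed.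

Lemma Cseries_cv_iff (f : nat -> Cpx) (l : Cpx) :
  Cseries_cv f l <-> is_cseries (fun n => toC (f n)) (toC l).
Proof.
  rewrite is_cseries_clim. unfold Cseries_cv, Ccv, clim. rewrite <- !is_lim_seq_Reals.
  split; intros [H1 H2]; split; [revert H1|revert H2|revert H1|revert H2]; apply is_lim_seq_ext;
    intros n; rewrite <- toC_partial; reflexivity.
Qed.

(** Once some limit exists, the one chosen by [epsilon] agrees with it by uniqueness. *)
Lemma toC_Cseries (f : nat -> Cpx) (l : C) :
  is_cseries (fun n => toC (f n)) l -> toC (Cseries f) = l.
Proof.
  intros H. assert (E : Cseries_cv f (Cseries f)).
  { apply (epsilon_spec (inhabits Defs.C0) (fun l => Cseries_cv f l)). exists (mkC (fst l) (snd l)). apply Cseries_cv_iff.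
    unfold toC at 2; simpl. now destruct l. }
  apply Cseries_cv_iff in E. apply is_cseries_unique in E. apply is_cseries_unique in H. congruence.
Qed.

Lemma toC_lambert (k : nat) (tau : Cpx) :
  Cmod (toC (qn tau)) < 1 -> toC (lambert k tau) = Lam k (toC (qn tau)).
Proof.
  intros H. apply toC_Cseries.
  apply is_cseries_ext with (fun n => RtoC (INR (S n) ^ k) * lamb (toC (qn tau)) (S n))%C.
  - intros n. now rewrite toC_mul, toC_div, toC_sub, toC_RtoC, toC_C1, toC_pow.
  (* [lambert] starts at n = 1, whereas [Lam] starts at n = 0 with a vanishing term. *)
  - apply (is_cseries_incr_1 (fun n => RtoC (INR n ^ k) * lamb (toC (qn tau)) n)%C).
    + now rewrite lamb_0, Cmult_0_r.
    + now apply is_cseries_Lam.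
Qed.

Lemma Cmod_qn (tau : Cpx) : Cmod (toC (qn tau)) = exp (- (2 * PI * Defs.Im tau)).
Proof.
  unfold qn, toC, Cexp, Cmod; simpl.
  set (x := 0 * Defs.Re tau - 2 * PI * Defs.Im tau).
  set (y := 0 * Defs.Im tau + 2 * PI * Defs.Re tau).
  replace (exp x * cos y * (exp x * cos y * 1) + exp x * sin y * (exp x * sin y * 1))
    with (exp x * exp x * ((sin y)² + (cos y)²)) by (unfold Rsqr; ring).
  rewrite sin2_cos2, Rmult_1_r, sqrt_square by (left; apply exp_pos).
  f_equal. unfold x. ring.
Qed.

Lemma Cmod_qn_lt (tau : Cpx) : 5 / 4 < Defs.Im tau -> Cmod (toC (qn tau)) < / 2500.
Proof.
  intros H. rewrite Cmod_qn, exp_Ropp. apply Rinv_lt_contravar.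
  - apply Rmult_lt_0_compat; [lra | apply exp_pos].
  - eapply Rlt_trans; [apply exp_gt_2500|]. apply exp_increasing. pose proof PI_RGT_0. nra.
Qed.

(** For w = a + bi one has |z| = a^2 + b^2, so the two radicands are a^2 and b^2; as a > 0, the sign
    of Im z = 2ab is that of b. *)
Lemma Csqrt_sqr (z : Cpx) (w : C) : toC z = (w * w)%C -> 0 < fst w -> toC (Csqrt z) = w.
Proof.
  intros E Hw. destruct w as [a b], z as [x y]. simpl in Hw.
  unfold toC in E; simpl in E. injection E as Ex Ey.
  unfold Csqrt, toC, Cnorm; simpl.
  assert (Er : sqrt (x * x + y * y) = a * a + b * b).
  { rewrite Ex, Ey. replace ((a * a - b * b) * (a * a - b * b) + (a * b + b * a) * (a * b + b * a))
      with ((a * a + b * b) * (a * a + b * b)) by ring.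
    apply sqrt_square. nra. }
  rewrite Er.
  replace ((a * a + b * b + x) / 2) with (a * a) by (rewrite Ex; field).
  replace ((a * a + b * b - x) / 2) with (b * b) by (rewrite Ex; field).
  rewrite (sqrt_square a) by lra. f_equal.
  destruct (Rlt_dec y 0) as [L|L].
  - replace (b * b) with ((- b) * (- b)) by ring. rewrite sqrt_square; [ring|]. nra.
  - apply sqrt_square. nra.
Qed.

Lemma toC_Eisenstein (tau : Cpx) : Cmod (toC (qn tau)) < 1 ->
  toC (E2 tau) = eisP (toC (qn tau)) /\ toC (E4 tau) = eisQ (toC (qn tau)) /\
  toC (E6 tau) = eisR (toC (qn tau)).
Proof.
  intros H. unfold E2, E4, E6, eisP, eisQ, eisR.
  now rewrite !toC_sub, !toC_add, !toC_mul, !toC_lambert.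
Qed.

Lemma toC_Jf (tau : Cpx) : Cmod (toC (qn tau)) < / 2500 -> toC (qn tau) <> 0 ->
  toC (Jf tau) = (/ inv_J (toC (qn tau)))%C /\ inv_J (toC (qn tau)) <> 0.
Proof.
  intros H Hn. destruct (toC_Eisenstein tau (Cmod_lt_1_of_small _ H)) as [_ [H4 H6]].
  pose proof (discriminant_neq_0 _ H Hn) as ND. pose proof (eisQ_neq_0 _ H) as NQ.
  rewrite inv_J_eq by assumption. split.
  - unfold Jf. rewrite toC_div, toC_sub, !toC_pow, H4, H6.
    set (d := (eisQ (toC (qn tau)) ^ 3 - eisR (toC (qn tau)) ^ 2)%C) in *.
    set (c := (eisQ (toC (qn tau)) ^ 3)%C).
    assert (c <> 0) by (now apply Cpow_nz). field. auto.
  - apply Cmult_neq_0; auto. intros K. pose proof (Cpow_nz _ 3 NQ) as N3.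
    apply C1_nz. transitivity (eisQ (toC (qn tau)) ^ 3 * / eisQ (toC (qn tau)) ^ 3)%C;
      [field; auto|]. rewrite K. ring.
Qed.

(** The power 1728^n moves into [hyp_coef], and the series splits into multiples of W_0 and W_1. *)
Lemma toC_ram_term (tau : Cpx) (n : nat) : Cmod (toC (qn tau)) < / 2500 -> toC (qn tau) <> 0 ->
  toC (ram_term tau n)
  = ((1 - toC (s2 tau)) / 6 * hyp_term 0 (inv_J (toC (qn tau))) n
     + hyp_term 1 (inv_J (toC (qn tau))) n)%C.
Proof.
  intros H Hn. destruct (toC_Jf tau H Hn) as [HJ NJ].
  unfold ram_term. rewrite !toC_mul, toC_add, toC_div, toC_sub, !toC_RtoC, toC_C1, toC_inv, toC_pow.
  rewrite toC_mul, toC_RtoC, HJ. set (y := inv_J (toC (qn tau))) in *.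
  unfold hyp_term, hyp_coef. rewrite pow_O, pow_1, Rmult_1_l, (RtoC_mult (INR n)).
  set (a := INR (fact (6 * n)) / (INR (fact (3 * n)) * INR (fact n) ^ 3)).
  assert (N1 : (1728 : C) <> 0) by (intros K; apply RtoC_inj in K; lra).
  rewrite Cpow_mult_l, Cpow_inv by assumption.
  rewrite (RtoC_div a) by (apply pow_nonzero; lra). rewrite RtoC_pow.
  pose proof (Cpow_nz _ n N1). pose proof (Cpow_nz _ n NJ). field. auto.
Qed.

Lemma toC_ram_lhs (tau : Cpx) : Cmod (toC (qn tau)) < / 2500 -> toC (qn tau) <> 0 ->
  toC (ram_lhs tau)
  = (RtoC (1 / (2 * PI * Defs.Im tau)) * (hypJ 0 (toC (qn tau)) * / eisS (toC (qn tau))))%C.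
Proof.
  intros H Hn. destruct (toC_Jf tau H Hn) as [HJ NJ].
  unfold ram_lhs. rewrite toC_mul, toC_RtoC. f_equal.
  apply Csqrt_sqr; [|now apply fst_hypJ_ratio_pos].
  rewrite hypJ_ratio_sqr by assumption.
  rewrite toC_div, toC_sub, toC_C1, HJ.
  pose proof (eisS_neq_0 _ H) as NS. pose proof (eisQ_neq_0 _ H) as NQ.
  assert (N1 : (1 - inv_J (toC (qn tau)))%C <> 0).
  { intros K. pose proof (fst_inv_1_minus_pos _ (Cmod_inv_J_lt_1 _ H)) as P. rewrite K in P.
    simpl in P. unfold Rdiv in P. rewrite Rmult_0_l in P. lra. }
  field. auto.
Qed.

Import Defs.

Theorem mainTheorem1 (tau : Cpx) (Htau : 5 / 4 < Im tau) :
  Cseries_cv (ram_term tau) (ram_lhs tau) /\ Cseries_abs_cv (ram_term tau).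
Proof.
  pose proof (Cmod_qn_lt tau Htau) as H.
  assert (Hn : toC (qn tau) <> 0) by (apply Cmod_gt_0; rewrite Cmod_qn; apply exp_pos).
  pose proof (Cmod_inv_J_lt_1 _ H) as Hy.
  set (q := toC (qn tau)) in *.
  split.
  - apply Cseries_cv_iff.
    apply is_cseries_ext with (fun n => (1 - toC (s2 tau)) / 6 * hyp_term 0 (inv_J q) n + hyp_term 1 (inv_J q) n)%C.
    { intros n; symmetry; now apply toC_ram_term. }
    (* Here s_2 = (P - 3/(pi Im tau))/S and W_1 = W_0 (P - S)/(6S); P cancels and W_0/(2 pi Im(tau)
       S) remains. *)
    assert (EL : toC (ram_lhs tau) = ((1 - toC (s2 tau)) / 6 * hyp 0 (inv_J q) + hyp 1 (inv_J q))%C).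
    { rewrite toC_ram_lhs by assumption.
      destruct (toC_Eisenstein tau (Cmod_lt_1_of_small _ H)) as [H2 [H4 H6]].
      unfold s2. rewrite toC_mul, toC_div, toC_sub, toC_RtoC, H2, H4, H6. fold q.
      pose proof (eisS_neq_0 q H) as NS. pose proof (eisQ_neq_0 q H) as NQ.
      assert (E1 : hypJ 1 q = (hypJ 0 q * ((eisP q - eisS q) / 6) / eisS q)%C).
      { rewrite <- hypJ_1_eq by assumption. field. auto. }
      fold (hypJ 0 q) (hypJ 1 q). rewrite E1, (eisR_eq q H).
      pose proof PI_RGT_0.
      rewrite !RtoC_div by nra. rewrite !RtoC_mult.
      assert ((PI : C) <> 0) by (intros K; apply RtoC_inj in K; lra).
      assert ((Defs.Im tau : C) <> 0) by (intros K; apply RtoC_inj in K; lra).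
      field. auto. }
    rewrite EL. apply is_cseries_plus; [apply is_cseries_scal|]; now apply is_cseries_hyp.
  (* Absolute convergence follows from the majorant K rho^n + n rho^n with |y| < rho < 1. *)
  - destruct (exists_radius_between _ Hy) as [rho [Hr Hr0]].
    set (K := Cmod ((1 - toC (s2 tau)) / 6)).
    assert (X : ex_series (fun n => Cnorm (ram_term tau n))).
    { apply (@ex_series_le R_AbsRing R_CompleteNormedModule _
        (fun n => K * (INR n ^ 0 * rho ^ n) + 1 * (INR n ^ 1 * rho ^ n))).
      - intros n. change (norm (Cnorm (ram_term tau n))) with (Rabs (Cnorm (ram_term tau n))).
        rewrite Cnorm_Cmod, Rabs_pos_eq by apply Cmod_ge_0.
        rewrite toC_ram_term by assumption. fold q.
        eapply Rle_trans; [apply Cmod_triangle|]. apply Rplus_le_compat.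
        + rewrite Cmod_mult. apply Rmult_le_compat_l; [apply Cmod_ge_0|].
          rewrite <- (Rmult_1_l (INR n ^ 0 * rho ^ n)). apply Cmod_hyp_term_le; lra.
        + apply Cmod_hyp_term_le; lra.
      - apply (ex_series_plus (fun n => K * (INR n ^ 0 * rho ^ n)) (fun n => 1 * (INR n ^ 1 * rho ^ n)));
          apply ex_series_pow_geom; try lra. apply Cmod_ge_0. }
    destruct X as [l Hl]. exists l. apply is_series_lim in Hl. now apply is_lim_seq_Reals.
Qed.
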